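(* Let $G$ be a contact Carnot group and $p=(x,z)\in G$, $p\neq p_0$. The set $\bar\Gamma_\infty(p)$ of equivalence classes of isometrically equivalent geodesics in $\Gamma_\infty(p)$, with the quotient topology, is homeomorphic to the disjoint union $$\bar\Gamma_\infty(p)\simeq\bigcup_{\lambda\in\Lambda_p}S^{\ell(\lambda)-1}_{\ge0},\qquad \ell(\lambda):=\#L(\lambda),$$ where $S^m_{\ge0}=S^m\cap\mathbb{R}^{m+1}_{\ge0}$ is the intersection of the $m$-sphere with the positive quadrant of $\mathbb{R}^{m+1}$.
   Context: A contact Carnot group $G$ is a connected, simply connected Lie group of dimension $2n+1$ whose Lie algebra of left-invariant vector fields splits as $\mathfrak g=\mathfrak g_1\oplus\mathfrak g_2$ with $\dim\mathfrak g_2=1$, $[\mathfrak g_1,\mathfrak g_1]=\mathfrak g_2$, $[\mathfrak g_1,\mathfrak g_2]=[\mathfrak g_2,\mathfrak g_2]=0$, with a scalar product on $\mathfrak g_1$ having orthonormal basis $f_1,\dots,f_{2n}$. Fix a generator $f_0$ of $\mathfrak g_2$; then $[f_i,f_j]=A_{ij}f_0$ for a skew-symmetric non-degenerate matrix $A$. Exponential coordinates: $p=(x,z)\in\mathbb{R}^{2n}\times\mathbb{R}$ means $p=\exp_G(\sum_i x_if_i+zf_0)$; $p_0=(0,0)$. Let $0<\alpha_1<\dots<\alpha_k$ be the distinct singular values of $A$ and $x_j\in\mathbb{R}^{2n_j}$ the projection of $x$ on the invariant subspace associated with $\alpha_j$. A geodesic is a non-constant Lipschitz curve $\gamma:[0,1]\to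 G$, tangent a.e. to $\mathfrak g_1$, locally minimizing the energy $\frac12\int_0^1\|\dot\gamma\|^2dt$. With $H(\eta)=\frac12\sum_i\langle\eta,f_i\rangle^2$ on $T^*G$, the exponential map is $\hat E(\eta)=\pi(e^{\vec H}(\eta))$, $\eta\in T_{p_0}^*G$ (the geodesic with initial covector $\eta$ being $t\mapsto\pi(e^{t\vec H}(\eta))$), and $\Gamma(p)=\hat E^{-1}(p)$ with the subspace topology is the set of geodesics from $p_0$ to $p$. Write $\eta=(u_1,\dots,u_k,\lambda)$, where $u=(\langle\eta,f_i\rangle)_i\in\mathbb{R}^{2n}$, $u_j\in\mathbb{R}^{2n_j}$ is its projection on the invariant subspace of $\alpha_j$, and $\lambda=\langle\eta,f_0\rangle$. Put $I_0=\{j\mid x_j=0\}$, $\Gamma_0(p)=\{(u,\lambda)\in\Gamma(p)\mid\sum_{j\in I_0}\|u_j\|^2=0\}$ and $\Gamma_\infty(p)=\Gamma(p)\setminus\Gamma_0(p)$. Define $g(\lambda)=\frac18\frac{\lambda-\sin\lambda}{(\sin\frac\lambda2)^2}$ (with $g(0)=0$; $g$ is odd, with poles on $2\pi\mathbb{Z}\setminus\{0\}$, where it is given the value $+\infty$ for $\lambda>0$ and $-\infty$ for $\lambda<0$), $\Lambda_j=\frac{2\pi}{\alpha_j}\mathbb{Z}\setminus\{0\}$, $\Lambda=\bigcup_{j=1}^k\Lambda_j$, $L(\lambda)=\{j\mid\lambda\in\Lambda_j\}$, and $$\Lambda_p=\Big\{\lambda\in\Lambda\ \Big|\ \Big(z-\sum_{j\notin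 I_0}\alpha_jg(\lambda\alpha_j)\|x_j\|^2\Big)\lambda>0\Big\}$$ (thus $\lambda\notin\Lambda_p$ if $\lambda\alpha_j$ is a pole of $g$ for some $j\notin I_0$). Two geodesics $\gamma_1,\gamma_2$ with the same endpoints are isometrically equivalent if $\gamma_1=\phi\circ\gamma_2$ for some sub-Riemannian isometry $\phi$ of $G$ fixing $p_0$ (a diffeomorphism preserving the sub-Riemannian structure). *)

(* Defs.v *)
From HB Require Import structures.
From mathcomp Require Import all_boot all_order all_algebra.
From mathcomp Require Import all_classical all_reals all_analysis.
From mathcomp Require Import ring lra.

Set Implicit Arguments.
Unset Strict Implicit.
Unset Printing Implicit Defensive.

Import Order.TTheory GRing.Theory Num.Theory.
Import numFieldNormedType.Exports.

Local Open Scope classical_set_scope.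
Local Open Scope ring_scope.

Definition homeomorphic (X Y : topologicalType) : Prop :=
  exists (f : X -> Y) (g : Y -> X),
    [/\ continuous f, continuous g, cancel f g & cancel g f].

(* The set of classes [set y | e x y] of a relation e, as a quotient of T, so
   that quotient_topology applies. It is the usual set of equivalence classes
   when e is an equivalence relation. *)
Section Classes.
Variables (T : Type) (e : T -> T -> Prop).

Definition eclass (x : T) : set T := [set y | e x y].

Definition classes : Type := {C : set T | exists x, eclass x = C}.

Definition classes_pi (x : T) : classes :=
  exist _ (eclass x) (ex_intro _ x erefl).

Definition classes_repr (C : classes) : T := projT1 (cid (projT2 C)).

Lemma classes_reprK : cancel classes_repr classes_pi.
Proof.
move=> [C exC]; apply: eq_exist => /=.
by rewrite /classes_repr; case: cid.
Qed.

HB.instance Definition _ := isQuotient.Build T classes classes_reprK.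
End Classes.

Section Smooth.
Variables (R : realType) (V W : normedModType R).

Fixpoint Ck (k : nat) (f : V -> W) : Prop :=
  if k is k'.+1 then
    (forall x, differentiable f x) /\ (forall v, Ck k' (fun x => 'D_v f x))
  else continuous f.

Definition smooth (f : V -> W) : Prop := forall k, Ck k f.
End Smooth.

Definition diffeomorphism (R : realType) (V : normedModType R) (f : V -> V) :=
  smooth f /\ exists g : V -> V, [/\ smooth g, cancel f g & cancel g f].

(* The structure constants [f_i, f_j] = A_ij f_0. *)
Definition contact_matrix (R : realType) (m : nat) (A : 'M[R]_m) : Prop :=
  A^T = - A /\ A \in unitmx.

(* Exponential coordinates (x, z). The same type is used for tangent vectors
   and, through cpair, for covectors. *)
Notation carnot R n := ('rV[R]_(2 * n) * R)%type.

Section Carnot.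
Variables (R : realType) (n : nat) (A : 'M[R]_(2 * n)).

Local Notation G := (carnot R n).

Definition dotv (m : nat) (u v : 'rV[R]_m) : R := \sum_i u 0 i * v 0 i.

Definition normv2 (m : nat) (u : 'rV[R]_m) : R := dotv u u.

Definition p0 : G := (0, 0).

(* exp X exp Y = exp (X + Y + [X, Y] / 2), as brackets of length 3 vanish. *)
Definition cmul (p q : G) : G :=
  (p.1 + q.1, p.2 + q.2 + 2^-1 * \sum_i \sum_j A i j * p.1 0 i * q.1 0 j).

(* The left-invariant vector field f_i, 1 <= i <= 2n: the derivative at t = 0
   of q * exp (t f_i). *)
Definition lfield (i : 'I_(2 * n)) (q : G) : G :=
  'D_1 (fun t : R => cmul q (t *: delta_mx 0 i, 0)) 0.

(* The horizontal vector with coordinates a in the orthonormal frame f_i. *)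
Definition hvec (q : G) (a : 'rV[R]_(2 * n)) : G := \sum_i a 0 i *: lfield i q.

(* A diffeomorphism whose differential maps the distribution to itself and
   preserves the scalar product on it. *)
Definition sr_isometry (phi : G -> G) : Prop :=
  diffeomorphism phi /\
  forall (q : G) (a b : 'rV[R]_(2 * n)), exists a' b' : 'rV[R]_(2 * n),
    [/\ 'D_(hvec q a) phi q = hvec (phi q) a',
        'D_(hvec q b) phi q = hvec (phi q) b' & dotv a' b' = dotv a b].

Definition cpair (eta v : G) : R := dotv eta.1 v.1 + eta.2 * v.2.

Definition hamiltonian (q eta : G) : R :=
  2^-1 * \sum_i cpair eta (lfield i q) ^+ 2.

(* Integral curves of the Hamiltonian vector field on T^*G = G x G with its
   canonical coordinates (q, eta): q' = dH/d eta, eta' = - dH/dq. *)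
Definition ham_curve (c : R -> G * G) : Prop :=
  forall t, [/\ derivable c t 1,
    forall w, cpair w ('D_1 c t).1 = 'D_w (hamiltonian (c t).1) (c t).2 &
    forall v, cpair ('D_1 c t).2 v = - 'D_v (hamiltonian^~ (c t).2) (c t).1].

(* t |-> e^(t vec H)(eta) for eta in T_p0^*G; the Hamiltonian field is complete,
   so this curve exists for all times, and it is unique. *)
Definition ham_flow (eta : G) : R -> G * G :=
  get [set c | ham_curve c /\ c 0 = (p0, eta)].

Definition geodesic (eta : G) (t : R) : G := (ham_flow eta t).1.

Definition Exp (eta : G) : G := geodesic eta 1.

Definition Gamma (p : G) : set G := Exp @^-1` [set p].

Definition iso_equiv (eta1 eta2 : G) : Prop :=
  exists phi : G -> G, [/\ sr_isometry phi, phi p0 = p0 &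
    forall t, 0 <= t <= 1 -> geodesic eta1 t = phi (geodesic eta2 t)].

Definition singular_value (a : R) : Prop :=
  0 <= a /\ eigenvalue (A^T *m A) (a ^+ 2).

Definition distinct_singular_values (k : nat) (alpha : 'I_k -> R) : Prop :=
  [/\ forall j, 0 < alpha j,
      forall i j : 'I_k, (i < j)%N -> alpha i < alpha j &
      forall a, singular_value a <-> exists j, a = alpha j].

(* The orthogonal projection x_j of x on the invariant subspace
   ker (A^T A - a^2), a = alpha_j, as a vector of R^2n; kermx V^T is the
   orthogonal complement of V. *)
Definition sv_proj (a : R) (x : 'rV[R]_(2 * n)) : 'rV[R]_(2 * n) :=
  let V := eigenspace (A^T *m A) (a ^+ 2) in x *m proj_mx V (kermx V^T).

Variables (k : nat) (alpha : 'I_k -> R).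

Definition I0 (x : 'rV[R]_(2 * n)) : {set 'I_k} :=
  [set j | sv_proj (alpha j) x == 0]%SET.

(* As f_i(p0) = (e_i, 0) and f_0(p0) = (0, 1), the coordinates of a covector eta
   at p0 are u = eta.1 and lambda = eta.2. *)
Definition Gamma0 (p : G) : set G :=
  [set eta | Gamma p eta /\
     \sum_(j in I0 p.1) normv2 (sv_proj (alpha j) eta.1) = 0].

Definition Gamma_inf (p : G) : set G := Gamma p `\` Gamma0 p.

Definition Gamma_inf_bar (p : G) : topologicalType :=
  quotient_topology
    (classes (fun eta1 eta2 : Gamma_inf p => iso_equiv (val eta1) (val eta2))).

Definition gfun (l : R) : \bar R :=
  if l == 0 then 0%E
  else if sin (l / 2) == 0 then (if 0 < l then +oo%E else -oo%E)
  else (8^-1 * ((l - sin l) / sin (l / 2) ^+ 2))%:E.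

Definition Lambda_j (j : 'I_k) : set R :=
  [set l | exists m : int, l = 2 * pi / alpha j * m%:~R /\ l <> 0].

Definition Lambda : set R := \bigcup_j Lambda_j j.

Definition L (l : R) : {set 'I_k} := [set j | `[< Lambda_j j l >]]%SET.

Definition ell (l : R) : nat := #|L l|.

Definition Lambda_p (p : G) : set R :=
  [set l | Lambda l /\
    (0 < (p.2%:E - \sum_(j in ~: I0 p.1)
            (alpha j)%:E * gfun (l * alpha j)
              * (normv2 (sv_proj (alpha j) p.1))%:E) * l%:E)%E].

End Carnot.

(* Checks that cmul is a group law with the prescribed structure constants. *)
Section CarnotFacts.
Variables (R : realType) (n : nat) (A : 'M[R]_(2 * n)).
Local Notation G := (carnot R n).

Lemma derive_affine (V W : normedModType R) (f : V -> W)
    (x v : V) (w : W) :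
  (forall h : R, f (h *: v + x) = f x + h *: w) -> 'D_v f x = w.
Proof.
move=> fE; rewrite /derive; apply: cvg_lim => //.
apply: cvg_near_cst; near=> h.
rewrite /= fE addrAC subrr add0r scalerA mulVf ?scale1r//.
by near: h; exact: nbhs_dnbhs_neq.
Unshelve. all: by end_near. Qed.

Lemma lfieldE i (q : G) :
  lfield A i q = (delta_mx 0 i, 2^-1 * \sum_k A k i * q.1 0 k).
Proof.
rewrite /lfield; apply: derive_affine => h.
rewrite /cmul/= addr0 scale0r.
have -> : h *: (1:R) = h by rewrite /GRing.scale/= mulr1.
apply/eqP; rewrite /eq_op/=; apply/andP; split; apply/eqP; first by rewrite addr0.
under [in RHS]eq_bigr do under eq_bigr do rewrite mxE mulr0.
under [in RHS]eq_bigr do rewrite sumr_const mul0rn.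
rewrite sumr_const mul0rn mulr0 !addr0 /GRing.scale/=.
congr (_ + _); rewrite [in RHS]mulrCA; congr (_ * _); rewrite mulr_sumr.
apply: eq_bigr => k _; rewrite (bigD1 i)//= big1 => [|j /negPf ji].
  by rewrite !mxE !eqxx/=; ring.
by rewrite !mxE ji andbF !mulr0.
Qed.

(* [f_i, f_j] = A_ij f_0, with f_0 = (0, 1). *)
Lemma lfield_bracket i j (q : G) : contact_matrix A ->
  'D_(lfield A i q) (lfield A j) q - 'D_(lfield A j q) (lfield A i) q
    = (0, A i j).
Proof.
move=> [skA _].
have D a b : 'D_(lfield A a q) (lfield A b) q = (0, 2^-1 * A a b).
  apply: derive_affine => h.
  rewrite !lfieldE/=; apply/eqP; rewrite /eq_op/=; apply/andP; split; apply/eqP.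
    by rewrite scaler0 addr0.
  rewrite /GRing.scale/= [h * (_ * _)]mulrCA -mulrDr; congr (_ * _).
  have E : \sum_k A k b * (h *: delta_mx 0 a + q.1 : 'rV[R]_(2*n)) 0 k =
    \sum_k (h * A k b * (delta_mx 0 a : 'rV[R]_(2*n)) 0 k) + \sum_k A k b * q.1 0 k.
    by rewrite -big_split; apply: eq_bigr => k _ /=; rewrite !mxE; ring.
  rewrite E addrC; congr (_ + _).
  rewrite (bigD1 a)//= big1 ?addr0 => [|k /negPf ka]; first by
    rewrite !mxE !eqxx mulr1.
  by rewrite !mxE ka andbF mulr0.
rewrite !D.
have -> : A j i = - A i j by move/matrixP: skA => /(_ i j); rewrite !mxE.
apply/eqP; rewrite /eq_op/=; apply/andP; split; apply/eqP; first by rewrite subr0.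
by field.
Qed.

Lemma cmulA (p q r : G) : cmul A p (cmul A q r) = cmul A (cmul A p q) r.
Proof.
rewrite /cmul/=; congr pair; first by rewrite addrA.
have e (x y w : 'rV[R]_(2 * n)) :
    \sum_i \sum_j A i j * x 0 i * (y + w) 0 j =
    \sum_i \sum_j A i j * x 0 i * y 0 j + \sum_i \sum_j A i j * x 0 i * w 0 j.
  rewrite -big_split; apply: eq_bigr => i _.
  by rewrite -big_split; apply: eq_bigr => j _ /=; rewrite mxE; ring.
have e' (x y w : 'rV[R]_(2 * n)) :
    \sum_i \sum_j A i j * (x + y) 0 i * w 0 j =
    \sum_i \sum_j A i j * x 0 i * w 0 j + \sum_i \sum_j A i j * y 0 i * w 0 j.
  rewrite -big_split; apply: eq_bigr => i _.
  by rewrite -big_split; apply: eq_bigr => j _ /=; rewrite mxE; ring.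
rewrite e e'; ring.
Qed.

Lemma cmulp0 (p : G) : cmul A p (p0 R n) = p.
Proof.
case: p => x z; rewrite /cmul/= big1 ?mulr0 ?addr0// => i _.
by rewrite big1// => j _; rewrite mxE mulr0.
Qed.

Lemma cmulpN (p : G) : contact_matrix A -> cmul A p (- p) = p0 R n.
Proof.
move=> [skA _]; rewrite /cmul/=; congr pair; first by rewrite subrr.
rewrite subrr add0r; set S := \sum_i _.
suff : S = - S by move=> h; lra.
rewrite {1}/S exchange_big/= /S -sumrN; apply: eq_bigr => i _.
rewrite -sumrN; apply: eq_bigr => j _; rewrite !mxE.
have -> : A j i = - A i j by move/matrixP: skA => /(_ i j); rewrite !mxE.
by ring.
Qed.
End CarnotFacts.

(* S^m_{>=0}, with the subspace topology of R^(m+1) *)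
Definition sphere_ge0 (R : realType) (m : nat) : set 'rV[R]_m.+1 :=
  [set v | normv2 v = 1 /\ forall i, 0 <= v 0 i].
Arguments sphere_ge0 : clear implicits.

(* Disjoint union over Lambda_p; ell l > 0 for l in Lambda_p. *)
Definition sphere_union (R : realType) (n : nat) (A : 'M[R]_(2 * n)) (k : nat)
    (alpha : 'I_k -> R) (p : carnot R n) : topologicalType :=
  {l : Lambda_p A alpha p & sphere_ge0 R (ell alpha (val l)).-1}.

(* Main.v *)
(* On the eigenspace of alpha_j the geodesic equations integrate explicitly with
   cos (l alpha_j t) and sin (l alpha_j t).  Hence eta = (u, l) lies in
   Gamma_inf p iff l is in Lambda_p, u_j is a prescribed vector for j outside
   L l, and the u_j with j in L l satisfy sum |u_j|^2 = C(l) for a constant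
   C(l) > 0.

   Two such covectors are isometrically equivalent iff they have the same l and
   the same norms |u_j|.  If the norms agree, unitary maps of the eigenspaces
   commuting with A give a linear isometry (x, z) |-> (x M, z).  Conversely, let
   phi be an isometry and X_a the left-invariant fields, with
   [X_a, X_b] = omega(a, b) Z.  Applying brackets to the condition that phi
   preserves the distribution shows that its horizontal differential M is
   orthogonal with M A M^T = c A and c^2 = 1; then Z phi is vertical, and the
   X-derivatives of M form a tensor that is symmetric in two slots and skew in
   two slots, so they vanish and M is constant along geodesics.  Hence phi
   preserves all |u_j| and maps l to c l, and c = 1 because l and z have the
   same sign.

   So the classes are parametrized by l and the vector (|u_j| / sqrt C(l)) with
   j in L l; this is a homeomorphism since Lambda is discrete. *)

Require Import Defs.
From HB Require Import structures.
From mathcomp Require Import all_boot all_order all_algebra.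
From mathcomp Require Import spectral complex.
From mathcomp Require Import all_classical all_reals all_analysis.
From mathcomp Require Import ring lra zify.

Set Implicit Arguments.
Unset Strict Implicit.
Unset Printing Implicit Defensive.

Import Order.TTheory GRing.Theory Num.Theory.
Import numFieldNormedType.Exports.

Local Open Scope classical_set_scope.
Local Open Scope ring_scope.

(** * The scalar product on row vectors *)

Section Dot.
Variables (R : realType) (m : nat).
Implicit Types (u v w : 'rV[R]_m) (B : 'M[R]_m).

Lemma dotvE u v : dotv u v = (u *m v^T) 0 0.
Proof. by rewrite /dotv mxE; apply: eq_bigr => i _; rewrite mxE. Qed.

Lemma dotv_mx u v : u *m v^T = (dotv u v)%:M.
Proof. by apply/matrixP => i j; rewrite !ord1 dotvE [in RHS]mxE. Qed.

Lemma dotvC u v : dotv u v = dotv v u.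
Proof. by apply: eq_bigr => i _; rewrite mulrC. Qed.

Lemma dotvDl u v w : dotv (u + v) w = dotv u w + dotv v w.
Proof. by rewrite !dotvE mulmxDl mxE. Qed.

Lemma dotvDr u v w : dotv u (v + w) = dotv u v + dotv u w.
Proof. by rewrite !(dotvC u) dotvDl. Qed.

Lemma dotvZl a u v : dotv (a *: u) v = a * dotv u v.
Proof. by rewrite !dotvE -scalemxAl mxE. Qed.

Lemma dotvZr a u v : dotv u (a *: v) = a * dotv u v.
Proof. by rewrite !(dotvC u) dotvZl. Qed.

Lemma dotvNl u v : dotv (- u) v = - dotv u v.
Proof. by rewrite -scaleN1r dotvZl mulN1r. Qed.

Lemma dotvNr u v : dotv u (- v) = - dotv u v.
Proof. by rewrite !(dotvC u) dotvNl. Qed.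

Lemma dotvBl u v w : dotv (u - v) w = dotv u w - dotv v w.
Proof. by rewrite dotvDl dotvNl. Qed.

Lemma dotvBr u v w : dotv u (v - w) = dotv u v - dotv u w.
Proof. by rewrite dotvDr dotvNr. Qed.

Lemma dot0v u : dotv 0 u = 0.
Proof. by rewrite dotvE mul0mx mxE. Qed.

Lemma dotv0 u : dotv u 0 = 0.
Proof. by rewrite dotvC dot0v. Qed.

Lemma dotv_suml (I : Type) (r : seq I) (P : pred I) (F : I -> 'rV[R]_m) v :
  dotv (\sum_(i <- r | P i) F i) v = \sum_(i <- r | P i) dotv (F i) v.
Proof.
by elim/big_rec2 : _ => [|i x y _ <-]; rewrite ?dot0v ?dotvDl.
Qed.

Lemma dotv_sumr (I : Type) (r : seq I) (P : pred I) (F : I -> 'rV[R]_m) v :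
  dotv v (\sum_(i <- r | P i) F i) = \sum_(i <- r | P i) dotv v (F i).
Proof. by rewrite dotvC dotv_suml; apply: eq_bigr => i _; rewrite dotvC. Qed.

Lemma dotvMl u v B : dotv (u *m B) v = dotv u (v *m B^T).
Proof. by rewrite !dotvE trmx_mul trmxK mulmxA. Qed.

Lemma normv2_ge0 u : 0 <= normv2 u.
Proof. by apply: sumr_ge0 => i _; rewrite -expr2 sqr_ge0. Qed.

Lemma normv2_eq0 u : (normv2 u == 0) = (u == 0).
Proof.
apply/idP/eqP => [|->]; last by rewrite /normv2 dot0v.
rewrite /normv2 psumr_eq0 => [/allP h|i _]; last by rewrite -expr2 sqr_ge0.
apply/rowP => i; rewrite mxE.
by have := h i (mem_index_enum _); rewrite /= mulf_eq0 orbb => /eqP.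
Qed.

Lemma normv2_gt0 u : (0 < normv2 u) = (u != 0).
Proof. by rewrite lt_def normv2_eq0 normv2_ge0 andbT. Qed.

Lemma normv20 : normv2 (0 : 'rV[R]_m) = 0.
Proof. exact: dot0v. Qed.

Lemma normv2Z a u : normv2 (a *: u) = a ^+ 2 * normv2 u.
Proof. by rewrite /normv2 dotvZl dotvZr mulrA. Qed.

Lemma dotv_inj u v : (forall w, dotv u w = dotv v w) -> u = v.
Proof.
move=> h; apply/eqP; rewrite -subr_eq0 -normv2_eq0 /normv2.
by rewrite dotvBl h subrr.
Qed.

End Dot.

(** * Spectral decomposition *)

Section SymmetricSpectrum.
Local Open Scope complex_scope.

(* Complexifying, the unitary diagonalization gives a basis of eigenvectors for
   real eigenvalues; inclusion of row spaces does not depend on the field. *)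
Lemma symmetric_eigenspaces_full (R : realType) (m : nat) (S W : 'M[R]_m) :
  S^T = S -> (forall a, (eigenspace S a <= W)%MS) -> (1%:M <= W)%MS.
Proof.
move=> symS hW.
pose f := @real_complex R.
pose S' := map_mx f S.
have S'herm : S' \is hermsymmx.
  apply: realsym_hermsym.
    apply/is_hermitianmxP; rewrite expr0 scale1r map_mx_id//.
    by apply/matrixP => i j; rewrite !mxE -[in RHS]symS mxE.
  by apply/mxOverP => i j; rewrite mxE; apply/complex_realP; exists (S i j).
have /orthomx_spectralP S'E := hermitian_normalmx S'herm.
have dreal := hermitian_spectral_diag_real S'herm.
set P := spectralmx S' in S'E; set d := spectral_diag S' in S'E dreal.
have Pu : P \in unitmx := spectral_unit S'.
have PS : P *m S' = diag_mx d *m P by rewrite S'E !mulmxA mulmxV// mul1mx.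
suff PW : (P <= map_mx f W)%MS.
  rewrite -(map_submx f) map_mx1; apply: submx_trans PW.
  by rewrite sub1mx row_full_unit.
apply/row_subP => i.
(* Row [i] of the unitary matrix is an eigenvector of [S'] for a real eigenvalue [r], hence lies in
   the complexified eigenspace of [S] for [r]. *)
have /mxOverP/(_ 0 i)/complex_realP [r dr] := dreal.
apply: (@submx_trans _ _ _ _ _ _ (map_mx f (eigenspace S r))); last first.
  by rewrite map_submx.
rewrite map_eigenspace; apply/eigenspaceP.
rewrite -row_mul PS.
apply/rowP => j; rewrite !mxE (bigD1 i)//= !mxE eqxx mulr1n dr big1 ?addr0//.
by move=> l /negPf li; rewrite !mxE eq_sym li mulr0n mul0r.
Qed.
End SymmetricSpectrum.

(** * Directional derivatives *)

Section Calculus.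
Variables (R : realType) (V : normedModType R).

Lemma is_deriveP (W : normedModType R) (f : V -> W) (x v : V) (df : W) :
  is_derive x v f df <-> h^-1 *: (f (h *: v + x) - f x) @[h --> 0^'] --> df.
Proof.
split=> [[fx <-]//|fdf].
have e : 'D_v f x = df by apply: cvg_lim.
by apply: DeriveDef => //; apply/cvg_ex; exists df.
Qed.

Lemma is_derive_pairP (W1 W2 : normedModType R) (f : V -> W1 * W2) x v df :
  is_derive x v f df <-> is_derive x v (fun y => (f y).1) df.1 /\
                         is_derive x v (fun y => (f y).2) df.2.
Proof.
case: df => d1 d2; rewrite !is_deriveP/=; split => [fdf|[f1 f2]].
  split.
    apply: (@cvg_comp _ _ _ _ fst _ _ _ fdf); exact: cvg_fst.
  apply: (@cvg_comp _ _ _ _ snd _ _ _ fdf); exact: cvg_snd.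
exact: cvg_trans (cvg_pair f1 f2).
Qed.

Lemma is_derive_rVP m (F : V -> 'rV[R]_m) x v (dF : 'rV[R]_m) :
  is_derive x v F dF <-> forall i, is_derive x v (fun y => F y 0 i) (dF 0 i).
Proof.
split=> [[Fx <-] i|h].
  apply: DeriveDef; first exact: ((derivable_mxP _ _ _).1 Fx).
  by rewrite derive_mx// mxE.
have Fx : derivable F x v by apply/derivable_mxP => i j; rewrite ord1;
  case: (h j).
apply: DeriveDef => //; rewrite derive_mx//; apply/rowP => i; rewrite mxE.
by case: (h i).
Qed.

Lemma is_derive_bigsum (I : finType) (F : I -> V -> R) x v (dF : I -> R) :
  (forall i, is_derive x v (F i) (dF i)) ->
  is_derive x v (fun y => \sum_i F i y) (\sum_i dF i).
Proof.
move=> h.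
have -> : (fun y => \sum_i F i y) = \sum_i F i.
  by apply/funext => y; rewrite fct_sumE.
elim/big_rec2 : _ => [|i d f _ hd]; first exact: is_derive_cst.
exact: is_deriveD.
Qed.

Lemma is_derive_prod (f g : V -> R) x v (df dg : R) :
  is_derive x v f df -> is_derive x v g dg ->
  is_derive x v (fun y => f y * g y) (df * g x + f x * dg).
Proof.
move=> fdf gdg; have := is_deriveM fdf gdg.
by rewrite /GRing.scale/= => /is_derive_eq; apply; ring.
Qed.

Lemma is_derive_mulmx m p (F : V -> 'rV[R]_m) x v dF (B : 'M[R]_(m, p)) :
  is_derive x v F dF -> is_derive x v (fun y => F y *m B) (dF *m B).
Proof.
move=> /is_derive_rVP h; apply/is_derive_rVP => i.
rewrite mxE; under eq_fun do rewrite mxE.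
apply: is_derive_bigsum => j; have := is_derive_prod (h j) (is_derive_cst (B j
  i) x v).
by move=> /is_derive_eq; apply; rewrite mulr0 addr0.
Qed.

Lemma is_derive_dotv m (F K : V -> 'rV[R]_m) x v dF dK :
  is_derive x v F dF -> is_derive x v K dK ->
  is_derive x v (fun y => dotv (F y) (K y)) (dotv dF (K x) + dotv (F x) dK).
Proof.
move=> /is_derive_rVP hF /is_derive_rVP hK.
rewrite /dotv -big_split; apply: is_derive_bigsum => i; exact: is_derive_prod.
Qed.

Lemma is_derive_lincomb (I : finType) m (a : I -> V -> R) (w : I -> 'rV[R]_m)
    x v (da : I -> R) : (forall i, is_derive x v (a i) (da i)) ->
  is_derive x v (fun y => \sum_i a i y *: w i) (\sum_i da i *: w i).
Proof.
move=> h; apply/is_derive_rVP => c.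
rewrite summxE; under eq_fun do rewrite summxE.
apply: is_derive_bigsum => i; rewrite mxE; under eq_fun do rewrite mxE.
have := is_derive_prod (h i) (is_derive_cst (w i 0 c) x v).
by move=> /is_derive_eq; apply; rewrite mulr0 addr0.
Qed.

Lemma is_derive_scal m (a : V -> R) (F : V -> 'rV[R]_m) x v da dF :
  is_derive x v a da -> is_derive x v F dF ->
  is_derive x v (fun y => a y *: F y) (da *: F x + a x *: dF).
Proof.
move=> ha /is_derive_rVP hF; apply/is_derive_rVP => i; rewrite !mxE.
under eq_fun do rewrite mxE.
exact: is_derive_prod.
Qed.

(** The difference quotient is exactly [a + h * b]. This serves to differentiate the Hamiltonian,
    which is quadratic along every line in [q] and in [eta]. *)
Lemma derive_quadratic (f : V -> R) x v (a b : R) :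
  (forall h, f (h *: v + x) = f x + h * a + h ^+ 2 * b) -> 'D_v f x = a.
Proof.
move=> fE; apply: cvg_lim => //=.
have -> : a = a + 0 * b by rewrite mul0r addr0.
apply: (@cvg_trans _ ((a + h * b) @[h --> (0 : R)^'])).
  apply: near_eq_cvg; near=> h; rewrite fE.
  have h0 : h != 0 by near: h; exact: nbhs_dnbhs_neq.
  by rewrite /GRing.scale/=; field.
apply: cvgD; first exact: cvg_cst.
by apply: cvgM; [apply: cvg_within|apply: cvg_cst].
Unshelve. all: by end_near. Qed.

End Calculus.

Lemma is_derive_0_rV (R : realType) m (F : R -> 'rV[R]_m) :
  (forall t, is_derive t (1 : R) F 0) -> forall s t, F s = F t.
Proof.
move=> h s t; apply/rowP => i.
apply: (@is_derive_0_is_cst _ (fun y => F y 0 i)) => y.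
by have /is_derive_rVP/(_ i) := h y; rewrite mxE.
Qed.

(** * Symmetry of second directional derivatives *)

Section SymmetricSecondDerivative.
Variables (R : realType) (V : normedModType R).

Lemma is_derive_line (f : V -> R) (c v : V) (s : R) :
  derivable f (s *: v + c) v ->
  is_derive s (1 : R) (fun r => f (r *: v + c)) ('D_v f (s *: v + c)).
Proof.
move=> fv; apply/is_deriveP.
have /is_deriveP : is_derive (s *: v + c) v f ('D_v f (s *: v + c)) by [].
apply: cvg_trans; apply: near_eq_cvg; near=> h.
by rewrite scalerDl addrA [_ *: (1 : R)]mulr1.
Unshelve. all: by end_near. Qed.

Lemma MVT_line (f : V -> R) (c v : V) (h : R) : 0 < h ->
  (forall x, derivable f x v) -> exists2 s, 0 < s < h &
  f (h *: v + c) - f c = 'D_v f (s *: v + c) * h.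
Proof.
move=> h0 fv.
have df s : is_derive s (1 : R) (fun r => f (r *: v + c)) ('D_v f (s *: v + c)).
  exact: is_derive_line.
have [|s] := MVT h0 (fun s _ => df s).
  by apply: derivable_within_continuous => s _; case: (df s).
by rewrite in_itv /= scale0r add0r subr0 => ? ->; exists s.
Qed.

(** The mean value theorem twice: along [v] for the increment [x |-> f (h *: w + x) - f x], then
    along [w] for ['D_v f]. *)
Lemma second_difference (f : V -> R) (q v w : V) (h : R) : 0 < h ->
  (forall x, derivable f x v) -> (forall x, derivable (fun y =>
    'D_v f y) x w) ->
  exists s t, [/\ 0 < s < h, 0 < t < h &
  f (h *: v + (h *: w + q)) - f (h *: v + q) - f (h *: w + q) + f q =
  'D_w (fun y => 'D_v f y) (t *: w + (s *: v + q)) * h ^+ 2].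
Proof.
move=> h0 fv fvw.
pose g x := f (h *: w + x) - f x.
have sw (x : V) : is_derive x v (fun y => f (h *: w + y)) ('D_v f (h *: w + x)).
  apply/is_deriveP.
  have /is_deriveP : is_derive (h *: w + x) v f ('D_v f (h *: w + x)) by [].
  by apply: cvg_trans; apply: near_eq_cvg; near=> r; rewrite addrCA.
have dg (x : V) : is_derive x v g ('D_v f (h *: w + x) - 'D_v f x).
  exact: is_deriveB (sw x) (derivableP (fv x)).
have [|s s0h gE] := @MVT_line g q v h h0; first by move=> x; case: (dg x).
have [t t0h tE] := @MVT_line (fun y => 'D_v f y) (s *: v + q) w h h0 fvw.
exists s, t; split => //.
transitivity (g (h *: v + q) - g q).
  by rewrite /g addrCA; ring.
rewrite gE; have -> : 'D_v g (s *: v + q) =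
  'D_v f (h *: w + (s *: v + q)) - 'D_v f (s *: v + q) by case: (dg (s *: v +
    q)).
by rewrite tE expr2 mulrA.
Unshelve. all: by end_near. Qed.

(** The second difference is symmetric in [v] and [w], so each mixed derivative takes the same value
    at some point close to [q], and continuity at [q] carries the equality over to [q]. *)
Lemma second_derive_sym (f : V -> R) (q v w : V) :
  (forall x u, derivable f x u) ->
  (forall x u u', derivable (fun y => 'D_u f y) x u') ->
  {for q, continuous (fun y => 'D_w (fun y => 'D_v f y) y)} ->
  {for q, continuous (fun y => 'D_v (fun y => 'D_w f y) y)} ->
  'D_w (fun y => 'D_v f y) q = 'D_v (fun y => 'D_w f y) q.
Proof.
move=> df ddf c1 c2; apply/eqP; rewrite -subr_eq0 -normr_le0.
apply/ler_addgt0Pl => e e0; rewrite addr0.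
have e2 : 0 < e / 2 by rewrite divr_gt0.
have /nbhs_ballP[r /= r0 rP] : \forall y \near q,
    `|'D_w (fun y => 'D_v f y) q - 'D_w (fun y => 'D_v f y) y| < e / 2 /\
    `|'D_v (fun y => 'D_w f y) q - 'D_v (fun y => 'D_w f y) y| < e / 2.
  by apply: filterI; [move/cvgrPdist_lt : c1|move/cvgrPdist_lt : c2]; exact.
(* With [h = r / N], every point [t *: b + (s *: a + q)] with [s, t] below [h] stays in the ball of
   radius [r]; the summand 1 keeps [N] positive when [v = w = 0]. *)
pose N := `|v| + `|w| + 1.
have N0 : 0 < N by rewrite /N ltr_wpDl// addr_ge0.
pose h := r / N.
have h0 : 0 < h by rewrite divr_gt0.
have small a b s t : a = v /\ b = w \/ a = w /\ b = v -> 0 < s < h ->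
  0 < t < h ->
    ball q r (t *: b + (s *: a + q)).
  move=> ab /andP[s0 sh] /andP[t0 th]; rewrite -ball_normE /ball_/=.
  rewrite addrA opprD addrCA subrr addr0 normrN.
  apply: (le_lt_trans (ler_normD _ _)); rewrite !normrZ !gtr0_norm//.
  have abE : `|a| + `|b| = `|v| + `|w| by case: ab => -[-> ->]//; exact: addrC.
  have rE : r = h * N by rewrite /h divfK// gt_eqF.
  have la := ler_wpM2r (normr_ge0 a) (ltW sh).
  have lb := ler_wpM2r (normr_ge0 b) (ltW th).
  by rewrite rE /N -abE !mulrDr mulr1; lra.
have [s [t [hs ht E1]]] := second_difference q h0 (df^~ v) (ddf^~ v ^~ w).
have [s' [t' [hs' ht' E2]]] := second_difference q h0 (df^~ w) (ddf^~ w ^~ v).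
have E : 'D_w (fun y => 'D_v f y) (t *: w + (s *: v + q)) =
         'D_v (fun y => 'D_w f y) (t' *: v + (s' *: w + q)).
  have hh : h ^+ 2 != 0 by rewrite expf_neq0// gt_eqF.
  apply: (mulIf hh); rewrite -E1 -E2 [h *: w + (h *: v + q)]addrCA.
  by move: (f _) (f _) (f _) (f _) => a b c d; ring.
have [l1 _] := rP _ (small v w s t (or_introl (conj erefl erefl)) hs ht).
have [_ l2] := rP _ (small w v s' t' (or_intror (conj erefl erefl)) hs' ht').
move: l1 l2; rewrite E.
move: ('D_w _ _) ('D_v _ q) ('D_v _ _) => a b c.
by clear; rewrite !ltr_norml ler_norml => /andP[? ?] /andP[? ?]; lra.
Qed.
End SymmetricSecondDerivative.

(** * Zeros of sine, discreteness, continuity *)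

Section SineZeros.
Variable R : realType.

Lemma sin_int_pi (m : int) : sin (m%:~R * pi) = 0 :> R.
Proof.
have nat_pi (i : nat) : sin (i%:R * pi) = 0 :> R.
  elim: i => [|i IH]; first by rewrite mul0r sin0.
  by rewrite -addn1 natrD mulrDl mul1r sinD IH sinpi mul0r mulr0 addr0.
case: m => i; first exact: nat_pi.
by rewrite NegzE mulrNz mulNr sinN -[_ *~ _]/(_%:R) nat_pi oppr0.
Qed.

(** Subtracting the largest multiple of [pi] below [x] leaves a zero of sine in [0, pi), where sine
    is positive except at 0. *)
Lemma sin_eq0P (x : R) : sin x = 0 <-> exists m : int, x = m%:~R * pi.
Proof.
split=> [sx0|[m ->]]; last exact: sin_int_pi.
exists (Num.floor (x / pi)); set m := Num.floor _.
have /andP[m1 m2] := floor_itv (x / pi); rewrite -/m in m1 m2.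
have pi0 := pi_gt0 R.
have y0 : 0 <= x - m%:~R * pi by rewrite subr_ge0 -ler_pdivlMr.
have y1 : x - m%:~R * pi < pi.
  by move: m2; rewrite ltr_pdivrMr// intrD mulrDl mul1r => m2; lra.
apply/eqP; rewrite -subr_eq0 eq_le y0 andbT leNgt; apply/negP => y_gt0.
have := sin_gt0_pi; move=> /(_ R (x - m%:~R * pi)).
by rewrite y_gt0 y1 sinB sx0 sin_int_pi mul0r mulr0 subrr ltxx => /(_ isT).
Qed.

Lemma cos_half (x : R) : cos x = 1 - 2 * sin (x / 2) ^+ 2.
Proof.
have -> : cos x = cos ((x / 2) *+ 2) by congr cos; rewrite -mulr_natr; field.
by rewrite cos_mulr2n cos2sin2; ring.
Qed.

Lemma sin_half (x : R) : sin x = 2 * (cos (x / 2) * sin (x / 2)).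
Proof.
have -> : sin x = sin ((x / 2) *+ 2) by congr sin; rewrite -mulr_natr; field.
by rewrite sin_mulr2n; ring.
Qed.

Lemma sin_le_id (y : R) : 0 <= y -> sin y <= y.
Proof.
rewrite le_eqVlt => /predU1P[<-|y0]; first by rewrite sin0.
have ds (x : R) : is_derive x (1 : R) sin (cos x) by exact: is_derive_sin.
have [|c _] := MVT y0 (fun x _ => ds x).
  by apply: derivable_within_continuous => x _; case: (ds x).
rewrite sin0 !subr0 => ->; rewrite -[leRHS]mul1r.
by apply: ler_wpM2r; [exact: ltW|exact: cos_le1].
Qed.

(** This is the sign of the numerator of g; it later forces [l] and [z] to have the same sign. *)
Lemma mul_sub_sin_ge0 (y : R) : 0 <= y * (y - sin y).
Proof.
have [y0|y0] := leP 0 y; first by rewrite mulr_ge0// subr_ge0 sin_le_id.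
have : sin (- y) <= - y by apply: sin_le_id; rewrite oppr_ge0 ltW.
by rewrite sinN lerN2 => ysy; rewrite mulr_le0 ?subr_le0// ltW.
Qed.

End SineZeros.

(** * Continuity of sums, products and row vectors *)

Section Continuity.
Variables (R : realType) (T : topologicalType).

Lemma continuous_bigsum (V : normedModType R) (I : Type) (r : seq I) (P : pred
  I)
    (F : I -> T -> V) : (forall i, P i -> continuous (F i)) ->
  continuous (fun t => \sum_(i <- r | P i) F i t).
Proof.
move=> cF; elim: r => [|i r IH].
  rewrite (_ : (fun t => _) = cst 0); first by move=> t; exact: cvg_cst.
  by apply/funext => t; rewrite big_nil.
rewrite (_ : (fun t => _) = fun t =>
    (if P i then F i t else 0) + \sum_(j <- r | P j) F j t); last first.
  by apply/funext => t; rewrite big_cons; case: ifP; rewrite ?add0r.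
move=> t; apply: cvgD; last exact: IH.
by case: ifPn => Pi; [exact: cF|exact: cvg_cst].
Qed.

Lemma continuous_mul (f g : T -> R) :
  continuous f -> continuous g -> continuous (fun t => f t * g t).
Proof. by move=> cf cg t; exact: cvgM (cf t) (cg t). Qed.

Lemma continuous_scal (V : normedModType R) (f : T -> R) (a : V) :
  continuous f -> continuous (fun t => f t *: a).
Proof. by move=> cf t; exact: cvgZr_tmp (cf t). Qed.

Lemma continuous_fcst (V : topologicalType) (a : V) : continuous (fun _ : T =>
  a).
Proof. by move=> t; exact: cvg_cst. Qed.

Lemma continuous_rV m (F : T -> 'rV[R]_m) :
  (forall i, continuous (fun t => F t 0 i)) -> continuous F.
Proof.
move=> cF.
have -> : F = fun t => \sum_i F t 0 i *: delta_mx 0 i.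
  by apply/funext => t; exact: row_sum_delta.
by apply: continuous_bigsum => i _; apply: continuous_scal; exact: cF.
Qed.
End Continuity.

(** If [x] is a multiple of [c], the interval between its two neighbours contains no other multiple;
    otherwise the interval between the consecutive multiples around [x] contains none. *)
Lemma lattice_isolated (R : realType) (c x : R) : 0 < c ->
  \forall y \near x, (exists m : int, y = c * m%:~R) -> y = x.
Proof.
move=> c0; have /andP[f1 f2] := floor_itv (x / c);
  set f := Num.floor _ in f1 f2.
have xf1 : c * f%:~R <= x by rewrite mulrC -ler_pdivlMr.
have xf2 : x < c * (f + 1)%:~R by rewrite mulrC -ltr_pdivrMr.
have mono (m m' : int) : c * m%:~R < c * m'%:~R -> m < m'.
  by rewrite ltr_pM2l// ltr_int.
have [xf|xf] := eqVneq x (c * f%:~R).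
  have : x \in `](c * (f - 1)%:~R), (c * (f + 1)%:~R)[.
    by rewrite in_itv/= xf2 andbT xf ltr_pM2l// ltr_int gtrDl.
  move=> /near_in_itvoo; apply: filterS => y.
  rewrite in_itv/= => /andP[y1 y2] [m ym]; rewrite {}ym in y1 y2 *.
  rewrite xf; congr (_ * _%:~R); move/mono: y1; move/mono : y2; lia.
have : x \in `](c * f%:~R), (c * (f + 1)%:~R)[.
  by rewrite in_itv/= xf2 andbT lt_def xf.
move=> /near_in_itvoo; apply: filterS => y.
rewrite in_itv/= => /andP[y1 y2] [m ym]; rewrite {}ym in y1 y2 *.
by exfalso; move/mono: y1; move/mono : y2; lia.
Qed.
(** * Orthogonal projections on the invariant subspaces *)

Section ContactGroup.
Variables (R : realType) (n : nat) (A : 'M[R]_(2 * n)).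
Variables (k : nat) (alpha : 'I_k -> R).
Hypothesis A_contact : contact_matrix A.
Hypothesis alpha_sv : distinct_singular_values A alpha.

Local Notation S := (A^T *m A).
Local Notation G := (carnot R n).
Local Notation rV := 'rV[R]_(2 * n).
Local Notation V j := (eigenspace S (alpha j ^+ 2)).

Definition sv_mx (j : 'I_k) : 'M[R]_(2 * n) := proj_mx (V j) (kermx (V j)^T).

Local Notation "x .{ j }" := (sv_proj A (alpha j) x)
  (at level 2, j at level 99, format "x .{ j }").

Lemma sv_projE j x : x.{j} = x *m sv_mx j.
Proof. by []. Qed.

Lemma A_skew : A^T = - A. Proof. by case: A_contact. Qed.

Lemma gramE : S = - (A *m A). Proof. by rewrite A_skew mulNmx. Qed.

Lemma A_inj (u : 'rV[R]_(2 * n)) : u *m A = 0 -> u = 0.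
Proof. by case: A_contact => _ Au uA; rewrite -(mulmxK Au u) uA mul0mx. Qed.

Lemma dotvA_skew (u v : 'rV[R]_(2 * n)) : dotv (u *m A) v = - dotv u (v *m A).
Proof. by rewrite dotvMl A_skew mulmxN dotvNr. Qed.

Lemma dotvA_id (u : 'rV[R]_(2 * n)) : dotv u (u *m A) = 0.
Proof. by have := dotvA_skew u u; rewrite dotvC; lra. Qed.

Lemma S_sym : S^T = S. Proof. by rewrite trmx_mul trmxK. Qed.

Lemma alpha_gt0 j : 0 < alpha j. Proof. by case: alpha_sv. Qed.

Lemma alpha_neq0 j : alpha j != 0. Proof. by rewrite gt_eqF// alpha_gt0. Qed.

Lemma alpha_inj i j : alpha i ^+ 2 = alpha j ^+ 2 -> i = j.
Proof.
move=> /eqP; rewrite eqrXn2 ?ltW ?alpha_gt0// => /eqP aij.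
case: alpha_sv => _ mono _; apply/val_inj => /=.
by case: (ltngtP i j) => // /mono; rewrite aij ltxx.
Qed.

Lemma eigen_orth (a b : R) (u v : 'rV[R]_(2 * n)) :
  u *m S = a *: u -> v *m S = b *: v -> a != b -> dotv u v = 0.
Proof.
move=> uS vS ab.
have : dotv (u *m S) v = dotv u (v *m S) by rewrite dotvMl S_sym.
rewrite uS vS dotvZl dotvZr => /eqP.
by rewrite -subr_eq0 -mulrBl mulf_eq0 subr_eq0 (negPf ab) => /eqP.
Qed.

Lemma cap_kermx_tr (U : 'M[R]_(2 * n)) : (U :&: kermx U^T = 0)%MS.
Proof.
apply/eqP/rowV0P => v; rewrite sub_capmx => /andP[/submxP[w ->]].
move/sub_kermxP => h; apply/eqP; rewrite -normv2_eq0 /normv2 dotvE.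
by rewrite trmx_mul mulmxA h mul0mx mxE.
Qed.

(** The rows of [W] lie in the eigenspace of [alpha i], which is that of [alpha j] or orthogonal to
    it. Any number of rows is allowed, so that [W] may be a vector or another projection. *)
Lemma sv_mx_eigen (m : nat) i j (W : 'M[R]_(m, 2 * n)) :
  W *m S = alpha i ^+ 2 *: W -> W *m sv_mx j = if i == j then W else 0.
Proof.
move=> WS; case: eqP => [ij|/eqP ij].
  apply: proj_mx_id; first exact: cap_kermx_tr.
  by apply/eigenspaceP; rewrite WS ij.
apply: proj_mx_0; first exact: cap_kermx_tr.
apply/sub_kermxP/matrixP => a b; rewrite [RHS]mxE.
have rV : row b (V j) *m S = alpha j ^+ 2 *: row b (V j).
  by apply/eigenspaceP; rewrite row_sub.
have rW : row a W *m S = alpha i ^+ 2 *: row a W.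
  by rewrite -row_mul WS; apply/rowP => c; rewrite !mxE.
have aij : alpha i ^+ 2 != alpha j ^+ 2.
  by apply: contra ij => /eqP /alpha_inj ->.
apply: etrans (eigen_orth rW rV aij); rewrite mxE; apply: eq_bigr => c _.
by rewrite !mxE.
Qed.

Lemma sv_mxS j : sv_mx j *m S = alpha j ^+ 2 *: sv_mx j.
Proof.
apply/eigenspaceP; rewrite -[X in (X <= _)%MS]mul1mx.
exact: proj_mx_sub.
Qed.

Lemma sv_mxM i j : sv_mx i *m sv_mx j = if i == j then sv_mx i else 0.
Proof. exact/sv_mx_eigen/sv_mxS. Qed.

(** [S] is positive semidefinite, so [a] is the square of the singular value [Num.sqrt a]. *)
Lemma eigenvalue_alpha a : eigenvalue S a -> exists j, a = alpha j ^+ 2.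
Proof.
move=> ev; have a_ge0 : 0 <= a.
  have /eigenvalueP[v vS v0] := ev.
  have := normv2_ge0 (v *m A^T).
  rewrite /normv2 -dotvMl -mulmxA vS dotvZl.
  by rewrite pmulr_lge0// normv2_gt0.
case: alpha_sv => _ _ /(_ (Num.sqrt a)) [+ _].
case=> [|j aj]; first by split; rewrite ?sqrtr_ge0// sqr_sqrtr.
by exists j; rewrite -aj sqr_sqrtr.
Qed.

(** By the spectral theorem every basis vector is a sum of eigenvectors, and each projection keeps
    exactly its own summand. *)
Lemma sv_mx_sum : \sum_j sv_mx j = 1%:M.
Proof.
pose T := (\sum_j V j)%MS.
have full : (1%:M <= T)%MS.
  apply: (@symmetric_eigenspaces_full _ _ S); first exact: S_sym.
  move=> a; have [ev|] := boolP (eigenvalue S a); last first.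
    by rewrite negbK => /eqP ->; rewrite sub0mx.
  have [j ->] := eigenvalue_alpha ev.
  exact: (sumsmx_sup j).
apply/row_matrixP => i.
have /sub_sumsmxP[u uE] := submx_trans (row_sub i 1%:M) full.
rewrite -[X in row i X]mul1mx row_mul uE mulmx_suml; apply: eq_bigr => j _.
rewrite mulmx_sumr (bigD1 j)//= big1 => [|l lj]; rewrite (@sv_mx_eigen _ j).
- by rewrite eqxx addr0.
- by apply/eigenspaceP; rewrite submxMl.
- by rewrite eq_sym (negPf lj).
- by apply/eigenspaceP; rewrite submxMl.
Qed.

(** [B] preserves each eigenspace of [S], so its off-diagonal blocks [sv_mx i *m B *m sv_mx l]
    vanish. *)
Lemma sv_mx_comm (B : 'M[R]_(2 * n)) j : comm_mx B S -> comm_mx B (sv_mx j).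
Proof.
move=> BS.
have e i l : sv_mx i *m B *m sv_mx l = if i == l then sv_mx i *m B else 0.
  by apply: sv_mx_eigen; rewrite -mulmxA BS mulmxA sv_mxS scalemxAl.
transitivity (sv_mx j *m B *m sv_mx j); last by rewrite e eqxx.
rewrite -{1}[B]mul1mx -sv_mx_sum !mulmx_suml (bigD1 j)//= big1 ?addr0// => i ij.
by rewrite e (negPf ij).
Qed.

(** Distinct images are orthogonal. Inserting the transposed sum of all projections on the right
    therefore gives [sv_mx j = sv_mx j *m (sv_mx j)^T], which is symmetric. *)
Lemma sv_mx_tr j : (sv_mx j)^T = sv_mx j.
Proof.
have e i l : i != l -> sv_mx i *m (sv_mx l)^T = 0.
  move=> il; apply/matrixP => a b; rewrite [RHS]mxE.
  have r c x : row x (sv_mx c) *m S = alpha c ^+ 2 *: row x (sv_mx c).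
    by rewrite -row_mul sv_mxS; apply/rowP => y; rewrite !mxE.
  have ail : alpha i ^+ 2 != alpha l ^+ 2.
    by apply: contra il => /eqP /alpha_inj ->.
  apply: etrans (eigen_orth (r i a) (r l b) ail); rewrite mxE;
    apply: eq_bigr => c _.
  by rewrite !mxE.
have -> : sv_mx j = sv_mx j *m (sv_mx j)^T.
  rewrite -{1}[sv_mx j]mulmx1 -(trmx1 R) -sv_mx_sum linear_sum mulmx_sumr.
  rewrite (bigD1 j)//= big1 ?addr0// => l lj.
  by rewrite e// eq_sym.
by rewrite trmx_mul trmxK.
Qed.

Lemma sv_mxA j : comm_mx A (sv_mx j).
Proof. by apply: sv_mx_comm; rewrite /comm_mx gramE mulmxN mulNmx mulmxA. Qed.

Lemma sv_projA x j : (x *m A).{j} = x.{j} *m A.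
Proof. by rewrite !sv_projE -[LHS]mulmxA (sv_mxA j : A *m _ = _) mulmxA. Qed.

Lemma sv_projD x y j : (x + y).{j} = x.{j} + y.{j}.
Proof. by rewrite !sv_projE mulmxDl. Qed.

Lemma sv_projZ a x j : (a *: x).{j} = a *: x.{j}.
Proof. by rewrite !sv_projE -scalemxAl. Qed.

Lemma sv_proj_sum (I : Type) (r : seq I) (P : pred I) (F : I -> 'rV_(2 * n)) j :
  (\sum_(i <- r | P i) F i).{j} = \sum_(i <- r | P i) (F i).{j}.
Proof. by rewrite sv_projE mulmx_suml. Qed.

Lemma sv_proj_proj x i j : x.{i}.{j} = if i == j then x.{i} else 0.
Proof. by rewrite !sv_projE -mulmxA sv_mxM; case: ifP => _;
  rewrite ?mulmx0. Qed.

Lemma sv_proj_decomp x : x = \sum_j x.{j}.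
Proof. by rewrite -{1}[x]mulmx1 -sv_mx_sum mulmx_sumr. Qed.

(** Thus [A / alpha j] is a complex structure on its block; this is the source of the cosines and
    sines in the flow. *)
Lemma sv_projAA x j : x.{j} *m A *m A = - alpha j ^+ 2 *: x.{j}.
Proof.
rewrite -mulmxA -[A *m A]opprK -gramE mulmxN sv_projE -mulmxA sv_mxS.
by rewrite -scalemxAr scaleNr.
Qed.

Lemma sv_proj_orth x y i j : i != j -> dotv x.{i} y.{j} = 0.
Proof.
by move=> ij; rewrite !sv_projE dotvMl sv_mx_tr -mulmxA sv_mxM eq_sym (negPf ij)
  mulmx0 dotv0.
Qed.

Lemma dotv_decomp x y : dotv x y = \sum_j dotv x.{j} y.{j}.
Proof.
rewrite {1}(sv_proj_decomp x) dotv_suml; apply: eq_bigr => i _.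
rewrite {1}(sv_proj_decomp y) dotv_sumr (bigD1 i)//= big1 ?addr0// => j ji.
by rewrite sv_proj_orth// eq_sym.
Qed.

Lemma normv2_projA x j : normv2 (x.{j} *m A) = alpha j ^+ 2 * normv2 x.{j}.
Proof.
by rewrite /normv2 dotvA_skew sv_projAA scaleNr dotvNr dotvZr opprK.
Qed.

Lemma sv_unit j : exists e : 'rV[R]_(2 * n), e.{j} = e /\ normv2 e = 1.
Proof.
case: alpha_sv => _ _ /(_ (alpha j)) [_ []]; first by exists j.
move=> _ /eigenvalueP[v vS v0].
exists ((Num.sqrt (normv2 v))^-1 *: v); split.
  by rewrite sv_projZ sv_projE (sv_mx_eigen _ vS) eqxx.
rewrite normv2Z exprVn sqr_sqrtr ?normv2_ge0// mulVf//.
by rewrite normv2_eq0.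
Qed.

(** * Transitivity of the unitary maps commuting with A *)

Definition outer (x y : rV) : 'M[R]_(2 * n) := x^T *m y.

Lemma outer_mul x y z w : outer x y *m outer z w = dotv y z *: outer x w.
Proof.
by rewrite /outer mulmxA -(mulmxA x^T) dotv_mx mul_mx_scalar -scalemxAl.
Qed.

Lemma mul_outer v x y : v *m outer x y = dotv v x *: y.
Proof. by rewrite /outer mulmxA dotv_mx mul_scalar_mx. Qed.

Lemma outer_tr x y : (outer x y)^T = outer y x.
Proof. by rewrite /outer trmx_mul trmxK. Qed.

Lemma outer_mulA x y : outer x y *m A = outer x (y *m A).
Proof. by rewrite /outer mulmxA. Qed.

Lemma A_mul_outer x y : A *m outer x y = - outer (x *m A) y.
Proof.
by rewrite /outer trmx_mul A_skew !mulNmx opprK mulmxA.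
Qed.

Lemma outerZl a x y : outer (a *: x) y = a *: outer x y.
Proof. by rewrite /outer linearZ -scalemxAl. Qed.

Lemma outerZr a x y : outer x (a *: y) = a *: outer x y.
Proof. by rewrite /outer -scalemxAr. Qed.

(* With d = u - w and the complex structure J = A / alpha_j on the block, the
   complex reflection v |-> v - ((v, d) / (u, d)) d is unitary and maps u to
   w; here (v, d) = <v, d> + i <v, d J>. *)
Lemma block_unitary j (u w : rV) : u.{j} = u -> w.{j} = w ->
  normv2 u = normv2 w ->
  exists M : 'M[R]_(2 * n), [/\ M *m M^T = 1%:M, comm_mx M A & u *m M = w].
Proof.
move=> uj wj uw.
have [->|neq_uw] := eqVneq u w.
  by exists 1%:M; split; rewrite ?trmx1 ?mulmx1// /comm_mx mul1mx mulmx1.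
have a0 := alpha_neq0 j.
pose d := u - w; pose e := (alpha j)^-1 *: (d *m A).
have dj : d.{j} = d by rewrite /d -scaleN1r sv_projD sv_projZ uj wj.
have dA : d *m A = alpha j *: e by rewrite scalerA mulfV// scale1r.
have eA : e *m A = - alpha j *: d.
  rewrite -scalemxAl -dj sv_projAA scalerA; congr (_ *: _).
  by field.
have de : dotv d e = 0 by rewrite dotvZr dotvA_id mulr0.
have ed : dotv e d = 0 by rewrite dotvC.
have ee : dotv e e = dotv d d.
  rewrite dotvZl dotvZr -[dotv (d *m A) _]/(normv2 _) -dj.
  by rewrite normv2_projA /normv2; field.
clearbody e.
pose s1 := dotv u d; pose s2 := dotv u e; pose D := dotv d d.
(* As |u| = |w|, |u - w|^2 = 2 <u, u - w>; this relation makes the reflection unitary. *)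
have Ds : D = 2 * s1.
  rewrite /D /s1 /d; rewrite !(dotvBl, dotvBr) (dotvC w u).
  by move: uw; rewrite /normv2 => ->; ring.
have s1_gt0 : 0 < s1.
  have : 0 < D by rewrite [D]/(normv2 d) normv2_gt0 subr_eq0.
  by rewrite Ds pmulr_rgt0.
pose N := s1 ^+ 2 + s2 ^+ 2.
have N_neq0 : N != 0 by rewrite gt_eqF// ltr_wpDr ?sqr_ge0// exprn_gt0.
(* [k1 + i k2] is the inverse of [(u, d) = s1 + i s2]. *)
pose k1 := s1 / N; pose k2 := - s2 / N.
have kD : D * (k1 ^+ 2 + k2 ^+ 2) = 2 * k1.
  by rewrite Ds /k1 /k2; move: N_neq0; rewrite /N => ?; field.
(* [P] is the real form of v |-> (v, d) d, and [Q] is [P] followed by J, since d J = e and e J = -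
   d. *)
pose P := outer d d + outer e e; pose Q := outer d e - outer e d.
have PP : P *m P = D *: P.
  by rewrite /P !(mulmxDl, mulmxDr, outer_mul) de ed ee !scale0r scalerDr
    !addr0 !add0r.
have QQ : Q *m Q = - D *: P.
  rewrite /P /Q !(mulmxDl, mulmxDr, mulmxN, mulNmx, outer_mul) de ed ee.
  by rewrite !scale0r !oppr0 !addr0 !add0r scalerDr !scaleNr.
have PQ : P *m Q = D *: Q.
  rewrite /P /Q !(mulmxDl, mulmxDr, mulmxN, mulNmx, outer_mul) de ed ee.
  by rewrite !scale0r !oppr0 !addr0 !add0r scalerBr.
have QP : Q *m P = D *: Q.
  rewrite /P /Q !(mulmxDl, mulmxDr, mulmxN, mulNmx, outer_mul) de ed ee.
  by rewrite !scale0r !oppr0 !addr0 !add0r scalerBr.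
have PT : P^T = P by rewrite linearD/= !outer_tr.
have QT : Q^T = - Q by rewrite linearB/= !outer_tr opprB.
have PA : P *m A = A *m P.
  rewrite /P mulmxDl mulmxDr !outer_mulA !A_mul_outer dA eA.
  by rewrite !(outerZl, outerZr) !scaleNr opprK addrC.
have QA : Q *m A = A *m Q.
  rewrite /Q mulmxBl mulmxBr !outer_mulA !A_mul_outer dA eA.
  by rewrite !(outerZl, outerZr) !scaleNr !opprK addrC.
have uP : u *m P = s1 *: d + s2 *: e by rewrite /P mulmxDr !mul_outer.
have uQ : u *m Q = s1 *: e - s2 *: d by rewrite /Q mulmxBr !mul_outer.
clearbody P Q.
exists (1%:M - (k1 *: P + k2 *: Q)); split.
- have -> : (1%:M - (k1 *: P + k2 *: Q))^T = 1%:M - (k1 *: P - k2 *: Q).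
    by rewrite linearB linearD !linearZ/= PT QT trmx1 scalerN.
  rewrite !(mulmxDl, mulmxDr, mulNmx, mulmxN, mul1mx, mulmx1) -!scalemxAl
    -!scalemxAr PP QQ PQ QP; apply/matrixP => a b; rewrite !mxE.
  move: (P a b) (Q a b) (_%:R) => p q i1.
  transitivity (i1 + (D * (k1 ^+ 2 + k2 ^+ 2) - 2 * k1) * p); first by ring.
  by rewrite kD subrr mul0r addr0.
- by rewrite /comm_mx mulmxBl mulmxBr mul1mx mulmx1 mulmxDl mulmxDr -!scalemxAl
    -!scalemxAr PA QA.
- rewrite mulmxBr mulmx1 mulmxDr -!scalemxAr uP uQ.
  apply/rowP => a; rewrite !mxE.
  have -> : w 0 a = u 0 a - (u 0 a - w 0 a) by ring.
  by rewrite /k1 /k2; move: N_neq0; rewrite /N => ?; field.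
Qed.

Lemma sv_mx_commA (M : 'M[R]_(2 * n)) j : comm_mx M A -> comm_mx M (sv_mx j).
Proof.
move=> MA; apply: sv_mx_comm.
by rewrite /comm_mx gramE mulmxN mulNmx !mulmxA MA -!mulmxA MA.
Qed.

(** The block maps are glued as [\sum_j sv_mx j *m M_ j]. Each [M_ j] commutes with [A], hence with
    all projections, so the cross terms of M M^T vanish. *)
Lemma unitary_transitive (u w : rV) : (forall j, normv2 u.{j} = normv2 w.{j}) ->
  exists M : 'M[R]_(2 * n), [/\ M *m M^T = 1%:M, comm_mx M A & u *m M = w].
Proof.
move=> uw.
have H j : exists M : 'M[R]_(2 * n),
    [/\ M *m M^T = 1%:M, comm_mx M A & u.{j} *m M = w.{j}].
  apply: (@block_unitary j); rewrite ?uw//;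
    by rewrite sv_proj_proj eqxx.
pose M_ j := projT1 (cid (H j)).
have MP j : [/\ M_ j *m (M_ j)^T = 1%:M, comm_mx (M_ j) A
  & u.{j} *m M_ j = w.{j}] by rewrite /M_; case: cid.
pose P_ := sv_mx.
have PM j i : M_ j *m P_ i = P_ i *m M_ j.
  by apply: sv_mx_commA; case: (MP j).
have PP i j : P_ i *m P_ j = if i == j then P_ i else 0.
  exact: sv_mxM.
have PT j : (P_ j)^T = P_ j by exact: sv_mx_tr.
exists (\sum_j P_ j *m M_ j); split.
- rewrite linear_sum/= mulmx_suml -sv_mx_sum.
  apply: eq_bigr => i _; rewrite mulmx_sumr (bigD1 i)//= big1 => [|j ji].
    rewrite addr0 trmx_mul PT -mulmxA (mulmxA (M_ i)).
    by case: (MP i) => -> _ _; rewrite mul1mx PP eqxx.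
  rewrite trmx_mul PT.
  have -> : (M_ j)^T *m P_ j = P_ j *m (M_ j)^T.
    by rewrite -[in LHS]PT -trmx_mul -PM trmx_mul PT.
  by rewrite -PM -mulmxA (mulmxA (P_ i)) PP eq_sym (negPf ji) mul0mx mulmx0.
- rewrite /comm_mx mulmx_suml mulmx_sumr; apply: eq_bigr => j _.
  rewrite -mulmxA; case: (MP j) => _ -> _; rewrite [LHS]mulmxA [RHS]mulmxA.
  by congr (_ *m _); exact/esym/sv_mxA.
- rewrite mulmx_sumr [RHS]sv_proj_decomp.
  by apply: eq_bigr => j _; case: (MP j) => _ _ <-; rewrite mulmxA.
Qed.

(** * The geodesic flow *)

(** The bracket form: [X_a, X_b] = omega(a, b) Z for the left-invariant fields, with Z = f_0. *)
Definition omega (u v : rV) : R := dotv (u *m A) v.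

Lemma hvecE (q : G) a : hvec A q a = (a, 2^-1 * dotv (q.1 *m A) a).
Proof.
rewrite /hvec; apply/pair_eqP; apply/andP; split; apply/eqP.
  rewrite (big_morph fst (id1 := 0) (op1 := +%R)) //=.
  rewrite [RHS]row_sum_delta; apply: eq_bigr => i _.
  by rewrite lfieldE.
rewrite (big_morph snd (id1 := 0) (op1 := +%R)) //= /dotv mulr_sumr.
apply: eq_bigr => i _; rewrite lfieldE/= /GRing.scale/= mxE.
under eq_bigr do rewrite mulrC.
by ring.
Qed.

(** Its entries are the pairings of [eta] with the fields f_i at [q]. *)
Definition momentum (q eta : G) : rV := eta.1 + (eta.2 / 2) *: (q.1 *m A).

Lemma hamiltonianE (q eta : G) :
  hamiltonian A q eta = 2^-1 * normv2 (momentum q eta).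
Proof.
rewrite /hamiltonian; congr (_ * _); apply: eq_bigr => i _.
rewrite expr2; suff -> : cpair eta (lfield A i q) = momentum q eta 0 i by [].
rewrite lfieldE /cpair/= !mxE; congr (_ + _); last first.
  rewrite mulrA; congr (_ * _); apply: eq_bigr => j _; exact: mulrC.
rewrite /dotv (bigD1 i)//= big1 => [|j ji]; rewrite !mxE ?eqxx ?mulr1 ?addr0//.
by rewrite (negPf ji) andbF mulr0.
Qed.

Lemma cpairC (X Y : G) : cpair X Y = cpair Y X.
Proof. by rewrite /cpair dotvC mulrC. Qed.

Lemma cpair_inj (X Y : G) : (forall w, cpair w X = cpair w Y) -> X = Y.
Proof.
case: X Y => [x z] [y t] h.
have -> : x = y.
  by apply: dotv_inj => w; have := h (w, 0); rewrite /cpair/= !mul0r !addr0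
    !(dotvC w).
by have := h (0, 1); rewrite /cpair/= !dot0v !add0r !mul1r => ->.
Qed.

Lemma derive_hamiltonian_cov (q eta w : G) : 'D_w (hamiltonian A q) eta =
  cpair w (momentum q eta, 2^-1 * dotv (momentum q eta) (q.1 *m A)).
Proof.
rewrite (_ : cpair _ _ = dotv (momentum q eta) (momentum q w)); last first.
  by rewrite /cpair/= [momentum q w]/momentum dotvDr dotvZr dotvC; ring.
apply: (derive_quadratic (b := 2^-1 * normv2 (momentum q w))) => h.
rewrite !hamiltonianE.
have -> : momentum q (h *: w + eta) = momentum q eta + h *: momentum q w.
  by apply/rowP => i; rewrite /momentum /= !mxE /GRing.scale/=; ring.
move: (momentum q eta) (momentum q w) => m m'.
rewrite /normv2 !(dotvDl, dotvDr, dotvZl, dotvZr) (dotvC m').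
by field.
Qed.

Lemma derive_hamiltonian_pos (q eta v : G) : 'D_v (hamiltonian A ^~ eta) q =
  - cpair ((eta.2 / 2) *: (momentum q eta *m A), 0) v.
Proof.
rewrite /cpair/= mul0r addr0 dotvZl dotvA_skew mulrN opprK -dotvZr.
apply: (derive_quadratic
  (b := 2^-1 * normv2 ((eta.2 / 2) *: (v.1 *m A)))) => h.
rewrite !hamiltonianE.
have -> : momentum (h *: v + q) eta =
    momentum q eta + h *: ((eta.2 / 2) *: (v.1 *m A)).
  rewrite /momentum /= mulmxDl -scalemxAl.
  by apply/rowP => i; rewrite !mxE; ring.
move: (momentum q eta) (v.1 *m A) => m m'.
rewrite /normv2 !(dotvDl, dotvDr, dotvZl, dotvZr) (dotvC m').
by field.
Qed.

Definition ham_field (c : G * G) : G * G :=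
  let h := momentum c.1 c.2 in
  ((h, 2^-1 * dotv h (c.1.1 *m A)), ((c.2.2 / 2) *: (h *m A), 0)).

Lemma ham_curveP (c : R -> G * G) :
  ham_curve A c <-> forall t, is_derive t (1 : R) c (ham_field (c t)).
Proof.
split=> [hc t|hc t].
  case: (hc t) => dc c1 c2; apply: DeriveDef => //.
  rewrite [LHS]surjective_pairing; congr pair.
    by apply: cpair_inj => w; rewrite c1 derive_hamiltonian_cov.
  apply: cpair_inj => w.
  by rewrite cpairC c2 derive_hamiltonian_pos opprK [RHS]cpairC.
case: (hc t) => dc ->; split => //= [w|v].
  by rewrite derive_hamiltonian_cov.
by rewrite derive_hamiltonian_pos opprK.
Qed.

Section Flow.
Variables (u : rV) (l : R).

(* The geodesic is x_j(t) = x_coef_u u_j + x_coef_uA u_j A and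
   z(t) = sum_j z_coef |u_j|^2; the case l = 0 is the limit of the formulas. *)
Definition x_coef_u (j : 'I_k) (t : R) : R :=
  if l == 0 then t else sin (l * alpha j * t) / (l * alpha j).
Definition x_coef_uA (j : 'I_k) (t : R) : R :=
  if l == 0 then 0 else (1 - cos (l * alpha j * t)) / (l * alpha j ^+ 2).
Definition z_coef (j : 'I_k) (t : R) : R :=
  if l == 0 then 0
  else (l * alpha j * t - sin (l * alpha j * t)) / (2 * l ^+ 2 * alpha j).

(** The momentum u exp(l t A), expanded on the blocks, where A^2 = - alpha_j^2. *)
Definition geo_h (t : R) : rV := \sum_j cos (l * alpha j * t) *: u.{j} +
  \sum_j (sin (l * alpha j * t) / alpha j) *: (u.{j} *m A).
Definition geo_x (t : R) : rV :=
  \sum_j x_coef_u j t *: u.{j} + \sum_j x_coef_uA j t *: (u.{j} *m A).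
Definition geo_z (t : R) : R := \sum_j z_coef j t * normv2 u.{j}.

Definition geo_curve (t : R) : G * G :=
  ((geo_x t, geo_z t), (geo_h t - (l / 2) *: (geo_x t *m A), l)).

Lemma is_derive_cosM (a t : R) :
  is_derive t (1 : R) (fun s => cos (a * s)) (- a * sin (a * t)).
Proof. by apply: trigger_derive; rewrite /GRing.scale/=; ring. Qed.

Lemma is_derive_sinM (a t : R) :
  is_derive t (1 : R) (fun s => sin (a * s)) (a * cos (a * t)).
Proof. by apply: trigger_derive; rewrite /GRing.scale/=; ring. Qed.

Lemma is_derive_x_coef_u j t : is_derive t (1 : R) (x_coef_u j) (cos (l * alpha
  j * t)).
Proof.
rewrite /x_coef_u; have [->|l0] := eqVneq l 0.
  by rewrite !mul0r cos0; exact: is_derive_id.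
have h := is_derive_prod (is_derive_sinM (l * alpha j) t)
  (is_derive_cst (l * alpha j)^-1 t 1).
by apply: (is_derive_eq h); have a0 := alpha_neq0 j; rewrite /cst /=; field;
  rewrite l0 a0.
Qed.

Lemma is_derive_x_coef_uA j t : is_derive t (1 : R) (x_coef_uA j) (sin (l *
  alpha j * t) / alpha j).
Proof.
rewrite /x_coef_uA; have [->|l0] := eqVneq l 0.
  by rewrite !mul0r sin0 mul0r; exact: is_derive_cst.
have h := is_derive_prod (is_deriveB (is_derive_cst (1 : R) t (1 : R))
  (is_derive_cosM (l * alpha j) t)) (is_derive_cst (l * alpha j ^+ 2)^-1 t 1).
by apply: (is_derive_eq h); have a0 := alpha_neq0 j; rewrite /cst /=; field;
  rewrite l0 a0.
Qed.

Lemma is_derive_z_coef j t : is_derive t (1 : R) (z_coef j)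
  (2^-1 * (alpha j * sin (l * alpha j * t) * x_coef_u j t -
           alpha j ^+ 2 * cos (l * alpha j * t) * x_coef_uA j t)).
Proof.
rewrite /z_coef /x_coef_u /x_coef_uA; have [->|l0] := eqVneq l 0.
  by rewrite !mul0r sin0 !mulr0 !mul0r subrr mulr0; exact: is_derive_cst.
have h := is_derive_prod (is_deriveB
  (is_derive_prod (is_derive_cst (l * alpha j) t 1) (is_derive_id t 1))
  (is_derive_sinM (l * alpha j) t)) (is_derive_cst (2 * l ^+ 2 * alpha j)^-1 t
    1).
apply: (is_derive_eq h).
have s2 : sin (l * alpha j * t) ^+ 2 = 1 - cos (l * alpha j * t) ^+ 2.
  by rewrite -(cos2Dsin2 (l * alpha j * t)); ring.
rewrite /cst /=; have a0 := alpha_neq0 j.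
set s := sin _ in s2 *; set c := cos _ in s2 *.
transitivity ((s ^+ 2 - c + c ^+ 2) / (2 * l)); last by field; rewrite l0 a0.
by rewrite s2; field; rewrite l0 a0.
Qed.

Lemma is_derive_geo_x t : is_derive t (1 : R) geo_x (geo_h t).
Proof.
apply: is_deriveD; apply: is_derive_lincomb => j.
  exact: is_derive_x_coef_u.
exact: is_derive_x_coef_uA.
Qed.

Lemma geo_hA t : geo_h t *m A =
  \sum_j (- (alpha j * sin (l * alpha j * t))) *: u.{j} +
  \sum_j cos (l * alpha j * t) *: (u.{j} *m A).
Proof.
rewrite mulmxDl !mulmx_suml addrC; congr (_ + _); apply: eq_bigr => j _;
  rewrite -scalemxAl// sv_projAA scalerA; congr (_ *: _).
by have a0 := alpha_neq0 j; rewrite /cst /=; field.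
Qed.

Lemma is_derive_geo_h t : is_derive t (1 : R) geo_h (l *: (geo_h t *m A)).
Proof.
rewrite geo_hA scalerDr !scaler_sumr.
under eq_bigr do rewrite scalerA.
under [X in _ + X]eq_bigr do rewrite scalerA.
apply: is_deriveD; apply: is_derive_lincomb => j.
  by apply: (is_derive_eq (is_derive_cosM (l * alpha j) t)); ring.
apply: (is_derive_eq (is_derive_prod (is_derive_sinM (l * alpha j) t)
  (is_derive_cst (alpha j)^-1 t (1 : R)))).
by have a0 := alpha_neq0 j; rewrite /cst /=; field.
Qed.

Lemma geo_h_proj t j : (geo_h t).{j} =
  cos (l * alpha j * t) *: u.{j} + (sin (l * alpha j * t) / alpha j) *: (u.{j}
    *m A).
Proof.
rewrite sv_projD !sv_proj_sum; congr (_ + _); rewrite (bigD1 j)//= big1 =>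
  [|i ij];
  by rewrite sv_projZ ?sv_projA sv_proj_proj ?eqxx ?addr0 ?(negPf ij) ?mul0mx
    ?scaler0.
Qed.

Lemma geo_x_proj t j : (geo_x t).{j} = x_coef_u j t *: u.{j} + x_coef_uA j t *:
  (u.{j} *m A).
Proof.
rewrite sv_projD !sv_proj_sum; congr (_ + _); rewrite (bigD1 j)//= big1 =>
  [|i ij];
  by rewrite sv_projZ ?sv_projA sv_proj_proj ?eqxx ?addr0 ?(negPf ij) ?mul0mx
    ?scaler0.
Qed.

(** [v.{j}] and its image under [A] are orthogonal, with lengths in ratio 1 : alpha_j. *)
Lemma dotv_proj_plane j (v : rV) a b c d :
  dotv (a *: v.{j} + b *: (v.{j} *m A)) (c *: v.{j} + d *: (v.{j} *m A)) =
  (a * c + alpha j ^+ 2 * b * d) * normv2 v.{j}.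
Proof.
rewrite !(dotvDl, dotvDr, dotvZl, dotvZr) dotvA_id.
rewrite (dotvC (v.{j} *m A)) dotvA_id -[dotv (v.{j} *m A) _]/(normv2 _).
by rewrite normv2_projA /normv2; ring.
Qed.

Lemma geo_area t : dotv (geo_h t) (geo_x t *m A) =
  \sum_j (alpha j * sin (l * alpha j * t) * x_coef_u j t -
           alpha j ^+ 2 * cos (l * alpha j * t) * x_coef_uA j t) * normv2 u.{j}.
Proof.
rewrite dotv_decomp; apply: eq_bigr => j _.
rewrite sv_projA geo_h_proj geo_x_proj mulmxDl -!scalemxAl sv_projAA.
rewrite scalerA [X in dotv _ X]addrC dotv_proj_plane.
by have a0 := alpha_neq0 j; rewrite /cst /=; field.
Qed.

Lemma is_derive_geo_z t : is_derive t (1 : R) geo_z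
  (2^-1 * dotv (geo_h t) (geo_x t *m A)).
Proof.
rewrite geo_area mulr_sumr; apply: is_derive_bigsum => j.
apply: (is_derive_eq (is_derive_prod (is_derive_z_coef j t)
  (is_derive_cst (normv2 u.{j}) t (1 : R)))).
by rewrite mulr0 addr0 mulrA.
Qed.

Lemma geo_x0 : geo_x 0 = 0.
Proof.
rewrite /geo_x !big1 ?addr0// => j _; rewrite /x_coef_u /x_coef_uA;
  case: ifP => _;
  by rewrite ?scale0r// ?mulr0 ?sin0 ?cos0 ?subrr ?mul0r scale0r.
Qed.

Lemma geo_h0 : geo_h 0 = u.
Proof.
rewrite /geo_h [RHS]sv_proj_decomp [X in _ + X]big1 ?addr0 => [|j _].
  by apply: eq_bigr => j _; rewrite mulr0 cos0 scale1r.
by rewrite mulr0 sin0 mul0r scale0r.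
Qed.

Lemma geo_z0 : geo_z 0 = 0.
Proof.
rewrite /geo_z big1// => j _; rewrite /z_coef; case: ifP => _; rewrite ?mul0r//.
by rewrite !mulr0 sin0 subrr !mul0r.
Qed.

Lemma momentum_geo t : momentum (geo_curve t).1 (geo_curve t).2 = geo_h t.
Proof. by rewrite /momentum/= subrK. Qed.

Lemma geo_curve_ham : ham_curve A geo_curve.
Proof.
apply/ham_curveP => t; apply/is_derive_pairP; split.
  apply/is_derive_pairP; split => /=; rewrite momentum_geo.
    exact: is_derive_geo_x.
  exact: is_derive_geo_z.
apply/is_derive_pairP; split => /=; last exact: is_derive_cst.
rewrite momentum_geo.
have h := is_deriveB (is_derive_geo_h t) (is_derive_scal (is_derive_cst (l / 2)
  t 1)
  (is_derive_mulmx A (is_derive_geo_x t))).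
apply: (is_derive_eq h); rewrite scale0r add0r -scalerBl; congr (_ *: _).
by rewrite /=; field.
Qed.

Lemma geo_curve0 : geo_curve 0 = (p0 R n, (u, l)).
Proof. by rewrite /geo_curve geo_x0 geo_z0 geo_h0 mul0mx scaler0 subr0. Qed.

(** The system is triangular. The last covector coordinate is constant; the momentum then solves m'
    = l m A, where skewness of [A] keeps the norm of the difference of two solutions constant;
    finally x and z have known derivatives. *)
Lemma ham_curve_unique c : ham_curve A c -> c 0 = (p0 R n, (u, l)) ->
  forall t, c t = geo_curve t.
Proof.
move=> /ham_curveP hc c0.
have hx t : is_derive t (1 : R) (fun s => (c s).1.1) (momentum (c t).1 (c t).2).
  by have /is_derive_pairP[/is_derive_pairP[]] := hc t.
have hz t : is_derive t (1 : R) (fun s => (c s).1.2)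
    (2^-1 * dotv (momentum (c t).1 (c t).2) ((c t).1.1 *m A)).
  by have /is_derive_pairP[/is_derive_pairP[]] := hc t.
have hxi t : is_derive t (1 : R) (fun s => (c s).2.1)
    (((c t).2.2 / 2) *: (momentum (c t).1 (c t).2 *m A)).
  by have /is_derive_pairP[_ /is_derive_pairP[]] := hc t.
have hl t : (c t).2.2 = l.
  suff -> : (c t).2.2 = (c 0).2.2 by rewrite c0.
  apply: (@is_derive_0_is_cst _ (fun s => (c s).2.2)) => s.
  by have /is_derive_pairP[_ /is_derive_pairP[]] := hc s.
pose m t := (c t).2.1 + (l / 2) *: ((c t).1.1 *m A).
have mE t : momentum (c t).1 (c t).2 = m t by rewrite /momentum hl.
have hm t : is_derive t (1 : R) m (l *: (m t *m A)).
  have h := is_deriveD (hxi t) (is_derive_scal (is_derive_cst (l / 2) t 1)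
    (is_derive_mulmx A (hx t))).
  apply: (is_derive_eq h).
  rewrite scale0r add0r hl mE -scalerDl; congr (_ *: _).
  by rewrite /=; field.
have mh t : m t = geo_h t.
  apply/eqP; rewrite -subr_eq0 -normv2_eq0.
  pose d s := m s - geo_h s.
  have hd s : is_derive s (1 : R) d (l *: (d s *m A)).
    apply: (is_derive_eq (is_deriveB (hm s) (is_derive_geo_h s))).
    by rewrite mulmxBl scalerBr.
  suff : normv2 (d t) = normv2 (d 0).
    by move=> ->; rewrite /d /m c0/= mul0mx scaler0 addr0 geo_h0 subrr normv20.
  apply: (@is_derive_0_is_cst _ (fun s => normv2 (d s))) => s;
    apply: (is_derive_eq (is_derive_dotv (hd s) (hd s))).
  by rewrite dotvZl dotvZr (dotvC (d s *m A)) dotvA_id mulr0 addr0.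
have xE t : (c t).1.1 = geo_x t.
  apply/eqP; rewrite -subr_eq0; apply/eqP.
  suff -> : (c t).1.1 - geo_x t = (c 0).1.1 - geo_x 0.
    by rewrite c0 geo_x0 subrr.
  apply: (@is_derive_0_rV _ _ (fun s => (c s).1.1 - geo_x s)) => s;
    apply: (is_derive_eq (is_deriveB (hx s) (is_derive_geo_x s))).
  by rewrite mE mh subrr.
have zE t : (c t).1.2 = geo_z t.
  apply/eqP; rewrite -subr_eq0; apply/eqP.
  suff -> : (c t).1.2 - geo_z t = (c 0).1.2 - geo_z 0.
    by rewrite c0 geo_z0 subrr.
  apply: (@is_derive_0_is_cst _ (fun s => (c s).1.2 - geo_z s)) => s;
    apply: (is_derive_eq (is_deriveB (hz s) (is_derive_geo_z s))).
  by rewrite mE mh xE subrr.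
move=> t; rewrite /geo_curve -xE -zE -mh /m addrK -(hl t).
by case: (c t) => [[? ?] [? ?]].
Qed.

(** [ham_flow] is a choice among integral curves; existence and uniqueness identify the chosen curve
    with the explicit one. *)
Lemma geodesicE t : geodesic A (u, l) t = (geo_x t, geo_z t).
Proof.
rewrite /geodesic /ham_flow; case: xgetP => [c _ [hc c0]|].
  by rewrite (ham_curve_unique hc c0).
move=> /(_ geo_curve) []; split; [exact: geo_curve_ham|exact: geo_curve0].
Qed.

End Flow.

(** * Linear isometries *)

Definition rot (M : 'M[R]_(2 * n)) (q : G) : G := (q.1 *m M, q.2).

Lemma rot_is_linear M : linear (rot M).
Proof.
by move=> a x y; rewrite /rot /= mulmxDl -scalemxAl.
Qed.

HB.instance Definition _ M :=
  GRing.isLinear.Build R G G *:%R (rot M) (rot_is_linear M).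

Lemma rot_differentiable M q : differentiable (rot M) q.
Proof.
apply: (@differentiable_pair _ _ _ _ (fun q : G => q.1 *m M) snd); last first.
  apply: linear_differentiable => x; exact: cvg_snd.
have -> : (fun q : G => q.1 *m M) =
    \sum_i (fun q : G => q.1 0 i *: row i M).
  by apply/funext => x; rewrite fct_sumE mulmx_sum_row.
apply: differentiable_sum => i; apply: differentiableZl.
apply: (@differentiable_comp _ _ _ _ fst (fun x : rV => x 0 i)).
  by apply: linear_differentiable => x; exact: cvg_fst.
exact: differentiable_coord.
Qed.

Lemma smooth_cst (a : G) : smooth (fun _ : G => a).
Proof.
move=> m; elim: m a => [|m IH] a /=; first by move=> x; exact: cvg_cst.
split=> [x|v]; first exact: differentiable_cst.
have -> : (fun x : G => 'D_v (fun _ : G => a) x) = (fun _ => 0).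
  by apply/funext => x; exact: derive_cst.
exact: IH.
Qed.

Lemma derive_rot M v q : 'D_v (rot M) q = rot M v.
Proof. by apply: derive_affine => h; rewrite linearP addrC. Qed.

Lemma rot_smooth M : smooth (rot M).
Proof.
case=> [|m] /=.
  by move=> q; exact/differentiable_continuous/rot_differentiable.
split=> [q|v]; first exact: rot_differentiable.
have -> : (fun x : G => 'D_v (rot M) x) = (fun _ => rot M v).
  by apply/funext => x; exact: derive_rot.
exact: smooth_cst.
Qed.

(** [M] preserves the scalar product and [omega], so [hvec q a] is sent to [hvec] at the image point
    with coordinates [a *m M]. *)
Lemma rot_sr_isometry M : M *m M^T = 1%:M -> comm_mx M A ->
  sr_isometry A (rot M).
Proof.
move=> MM MA; have MM' : M^T *m M = 1%:M by apply: mulmx1C.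
have dotM (a b : rV) : dotv (a *m M) (b *m M) = dotv a b.
  by rewrite dotvMl -mulmxA MM mulmx1.
split=> [|q a b].
  split; first exact: rot_smooth.
  exists (rot M^T); split; first exact: rot_smooth.
    by case=> x z; rewrite /rot/= -mulmxA MM mulmx1.
  by case=> x z; rewrite /rot/= -mulmxA MM' mulmx1.
exists (a *m M), (b *m M); rewrite !derive_rot !hvecE /rot /=.
by rewrite -mulmxA MA mulmxA !dotM.
Qed.

Lemma geodesic_rot M u l t : M *m M^T = 1%:M -> comm_mx M A ->
  geodesic A (u *m M, l) t = rot M (geodesic A (u, l) t).
Proof.
move=> MM MA; rewrite !geodesicE /rot/=.
have pM j : (u *m M).{j} = u.{j} *m M.
  by rewrite !sv_projE -mulmxA (sv_mx_commA j MA : M *m _ = _) mulmxA.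
congr pair.
  rewrite /geo_x mulmxDl !mulmx_suml; congr (_ + _); apply: eq_bigr => j _;
    rewrite pM -scalemxAl//.
  by rewrite -mulmxA MA mulmxA.
apply: eq_bigr => j _; rewrite pM; congr (_ * _).
by rewrite /normv2 dotvMl -mulmxA MM mulmx1.
Qed.

Lemma iso_equiv_of_norms u w l : (forall j, normv2 u.{j} = normv2 w.{j}) ->
  iso_equiv A (u, l) (w, l).
Proof.
move=> uw; have [|M [MM MA wM]] := @unitary_transitive w u.
  by move=> j; rewrite uw.
exists (rot M); split; first exact: rot_sr_isometry.
  by rewrite /rot mul0mx.
by move=> t _; rewrite -wM geodesic_rot.
Qed.

(** * Rigidity of isometries *)

(* Sealing the derivative keeps unification from unfolding limits. *)
Definition dirderiv : G -> (G -> R) -> G -> R := locked (fun v F q => 'D_v F q).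

Lemma dirderivE v F q : dirderiv v F q = 'D_v F q.
Proof. by rewrite /dirderiv -lock. Qed.

Lemma dirderiv_val v F q d : is_derive q v F d -> dirderiv v F q = d.
Proof. by rewrite dirderivE => -[]. Qed.

Lemma is_derive_dirderiv v F q : differentiable F q ->
  is_derive q v F (dirderiv v F q).
Proof. by move=> dF; rewrite dirderivE; exact/derivableP/diff_derivable. Qed.

Definition C2 (F : G -> R) : Prop :=
  [/\ forall x, differentiable F x,
      forall u x, differentiable (dirderiv u F) x &
      forall u v, continuous (dirderiv v (dirderiv u F))].

(** The derivative X_a F along a left-invariant field; [dvert] below is Z F. *)
Definition dhor (a : rV) (F : G -> R) (q : G) : R := dirderiv (hvec A q a) F q.

Definition evert : G := (0, 1).
Definition ehor (a : rV) : G := (a, 0).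

Definition dvert (F : G -> R) : G -> R := dirderiv evert F.

Lemma dirderivDZ (F : G -> R) q (v w : G) (c : R) : differentiable F q ->
  dirderiv (v + c *: w) F q = dirderiv v F q + c * dirderiv w F q.
Proof. by move=> dF; rewrite !dirderivE !deriveE// linearD linearZ. Qed.

Definition lift_coef (a : rV) (q : G) : R := 2^-1 * dotv (q.1 *m A) a.

Lemma hvec_split q a : hvec A q a = ehor a + lift_coef a q *: evert.
Proof.
by rewrite hvecE; congr pair => /=; rewrite ?scaler0 ?addr0// add0r
  /GRing.scale/= mulr1.
Qed.

Lemma dhorE a F q : differentiable F q ->
  dhor a F q = dirderiv (ehor a) F q + lift_coef a q * dvert F q.
Proof. by move=> dF; rewrite /dhor hvec_split dirderivDZ. Qed.

Lemma is_derive_fst1 (q v : G) : is_derive q v (fun y : G => y.1) v.1.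
Proof. by have /is_derive_pairP[] := is_derive_id q v. Qed.

Lemma is_derive_lift_coef a (q v : G) :
  is_derive q v (lift_coef a) (lift_coef a v).
Proof.
have h1 := is_derive_dotv (is_derive_mulmx A (is_derive_fst1 q v))
  (is_derive_cst a q v).
have h2 := is_derive_prod (is_derive_cst (2^-1 : R) q v) h1.
by apply: (is_derive_eq h2); rewrite /cst dotv0 addr0 mul0r add0r.
Qed.

Lemma is_derive_dhor a F (q v : G) : C2 F -> is_derive q v (dhor a F)
  (dirderiv v (dirderiv (ehor a) F) q +
   (lift_coef a v * dvert F q + lift_coef a q * dirderiv v (dvert F) q)).
Proof.
move=> [dF ddF _].
have -> : dhor a F = fun y => dirderiv (ehor a) F y + lift_coef a y * dvert F y.
  by apply/funext => y; rewrite dhorE.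
apply: is_deriveD; first by apply: is_derive_dirderiv; exact: ddF.
apply: is_derive_prod; first exact: is_derive_lift_coef.
by apply: is_derive_dirderiv; exact: ddF.
Qed.

Lemma C2_sym F u v q : C2 F -> dirderiv v (dirderiv u F) q = dirderiv u
  (dirderiv v F) q.
Proof.
move=> [dF ddF cF].
have e w : dirderiv w F = fun y => 'D_w F y by apply/funext => y;
  exact: dirderivE.
have ee w w' : dirderiv w (dirderiv w' F) = fun y => 'D_w (fun z =>
  'D_w' F z) y.
  by apply/funext => y; rewrite dirderivE e.
rewrite !ee; apply: second_derive_sym.
- by move=> x w; exact: diff_derivable.
- by move=> x w w'; rewrite -e; apply: diff_derivable; exact: ddF.
- by rewrite -ee; exact: cF.
- by rewrite -ee; exact: cF.
Qed.

Lemma lift_coef_hvec a b q : lift_coef b (hvec A q a) = 2^-1 * omega a b.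
Proof. by rewrite hvecE. Qed.

Lemma dhor_dhor a b F q : C2 F -> dhor a (dhor b F) q =
  dirderiv (ehor a) (dirderiv (ehor b) F) q
  + lift_coef a q * dirderiv (ehor b) (dvert F) q
  + (2^-1 * omega a b * dvert F q
  + lift_coef b q * (dirderiv (ehor a) (dvert F) q + lift_coef a q * dvert
    (dvert F) q)).
Proof.
move=> C2F; have [dF ddF cF] := C2F.
rewrite [LHS]/dhor (dirderiv_val (is_derive_dhor b q (hvec A q a) C2F))
  lift_coef_hvec.
rewrite hvec_split (dirderivDZ _ _ _ (ddF (ehor b) q)) (dirderivDZ _ _ _ (ddF
  evert q)).
by rewrite (C2_sym (ehor b) evert q C2F).
Qed.

(** Second-order terms are symmetric and cancel; what is left comes from differentiating the
    vertical coefficients [lift_coef]. *)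
Lemma dhor_bracket a b F q : C2 F ->
  dhor a (dhor b F) q - dhor b (dhor a F) q = omega a b * dvert F q.
Proof.
move=> C2F; rewrite (dhor_dhor a b q C2F) (dhor_dhor b a q C2F).
have -> : omega b a = - omega a b by rewrite /omega dotvA_skew dotvC.
rewrite (C2_sym (ehor a) (ehor b) q C2F).
move: (dirderiv (ehor b) (dirderiv (ehor a) F) q) => T1.
move: (dirderiv (ehor b) (dvert F) q) (dirderiv (ehor a) (dvert F) q) (dvert
  (dvert F) q) (dvert F q).
move=> T2 T3 T4 T5; by field.
Qed.

(** Z is central: the coefficients of X_a do not depend on z. *)
Lemma dvert_dhor a F q : C2 F -> dvert (dhor a F) q = dhor a (dvert F) q.
Proof.
move=> C2F; have [dF ddF cF] := C2F.
rewrite [LHS]/dvert (dirderiv_val (is_derive_dhor a q evert C2F)) (dhorE _ (ddF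
  evert q)).
have -> : lift_coef a evert = 0 by rewrite /lift_coef mul0mx dot0v mulr0.
by rewrite mul0r add0r (C2_sym (ehor a) evert q C2F).
Qed.

Lemma omegaC a b : omega a b = - omega b a.
Proof. by rewrite /omega dotvA_skew dotvC. Qed.

Lemma omegaZr a b (c : R) : omega a (c *: b) = c * omega a b.
Proof. by rewrite /omega dotvZr. Qed.

Lemma omegaBr a b c : omega a (b - c) = omega a b - omega a c.
Proof. by rewrite /omega dotvBr. Qed.

(** * The differential of an isometry in the left-invariant frame *)

Section Isometry.
Variable phi : G -> G.
Hypothesis phi_iso : sr_isometry A phi.

(** Meant for coordinate functions [f] of G: the second hypothesis lets [f] pass through
    derivatives, so the smoothness of [phi] transfers to its coordinates. *)
Lemma C2_linear (f : G -> R) :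
  (forall x, differentiable f x) ->
  (forall (g : G -> G) x v dg, is_derive x v g dg ->
     is_derive x v (fun y => f (g y)) (f dg)) -> C2 (fun q => f (phi q)).
Proof.
move=> df lf; case: phi_iso => -[/(_ 2%N)/= [d1 d2] _] _.
have cf : continuous f by move=> x; exact/differentiable_continuous.
have e1 u : dirderiv u (fun q => f (phi q)) = (fun y => f ('D_u phi y)).
  apply/funext => y; apply: dirderiv_val; apply: lf.
  exact/derivableP/diff_derivable.
have e2 u v : dirderiv v (fun q => f ('D_u phi q)) =
    (fun y => f ('D_v (fun z => 'D_u phi z) y)).
  apply/funext => y; apply: dirderiv_val; apply: lf.
  by apply/derivableP/diff_derivable; case: (d2 u).
split=> [x|u x|u v].
- by apply: (@differentiable_comp _ _ _ _ phi f).
- rewrite e1; apply: (@differentiable_comp _ _ _ _ (fun y =>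
  'D_u phi y) f) => //.
  by case: (d2 u).
- rewrite e1 e2.
  move=> y; apply: (@continuous_comp _ _ _ (fun y => 'D_v (fun z =>
    'D_u phi z) y) f).
    by case: (d2 u) => _ /(_ v); apply.
  exact: cf.
Qed.

Definition iso_z (q : G) : R := (phi q).2.
Definition iso_x (q : G) : rV := (phi q).1.
Definition iso_coord (i : 'I_(2 * n)) (q : G) : R := iso_x q 0 i.

Lemma C2_iso_z : C2 iso_z.
Proof.
apply: (@C2_linear snd) => [x|g x v dg].
  by apply: linear_differentiable => y; exact: cvg_snd.
by move=> /is_derive_pairP[].
Qed.

Lemma C2_iso_coord i : C2 (iso_coord i).
Proof.
apply: (@C2_linear (fun q : G => q.1 0 i)) => [x|g x v dg].
  apply: (@differentiable_comp _ _ _ _ fst (fun x : rV => x 0 i)).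
    by apply: linear_differentiable => y; exact: cvg_fst.
  exact: differentiable_coord.
by move=> /is_derive_pairP[/is_derive_rVP].
Qed.

Lemma derive_iso_x v q : is_derive q v iso_x ('D_v phi q).1.
Proof.
case: phi_iso => -[/(_ 1%N)/= [d1 _] _] _.
by have /is_derive_pairP[] := derivableP (diff_derivable (v := v) (d1 q)).
Qed.

Lemma derive_iso_z v q : is_derive q v iso_z ('D_v phi q).2.
Proof.
case: phi_iso => -[/(_ 1%N)/= [d1 _] _] _.
by have /is_derive_pairP[] := derivableP (diff_derivable (v := v) (d1 q)).
Qed.

(** Frame coordinates of the image of X_a: those of a horizontal vector are its x-components. *)
Definition iso_push (a : rV) (q : G) : rV := \row_i dhor a (iso_coord i) q.
Definition iso_vert (q : G) : rV := \row_i dvert (iso_coord i) q.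

Lemma is_derive_iso_x v q : is_derive q v iso_x (\row_i dirderiv v (iso_coord
  i) q).
Proof.
apply/is_derive_rVP => i; rewrite mxE.
by apply: is_derive_dirderiv; case: (C2_iso_coord i).
Qed.

Lemma is_derive_iso_x_hor a q : is_derive q (hvec A q a) iso_x (iso_push a q).
Proof. exact: is_derive_iso_x. Qed.

Lemma is_derive_iso_x_vert q : is_derive q evert iso_x (iso_vert q).
Proof. exact: is_derive_iso_x. Qed.

Lemma is_derive_iso_push a v q : is_derive q v (iso_push a) (\row_i dirderiv v
  (dhor a (iso_coord i)) q).
Proof.
apply/is_derive_rVP => i; rewrite mxE; under eq_fun do rewrite mxE.
by have h := is_derive_dhor a q v (C2_iso_coord i); rewrite (dirderiv_val h).
Qed.

Lemma is_derive_iso_vert v q : is_derive q v iso_vert (\row_i dirderiv v (dvert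
  (iso_coord i)) q).
Proof.
apply/is_derive_rVP => i; rewrite mxE; under eq_fun do rewrite mxE.
by apply: is_derive_dirderiv; case: (C2_iso_coord i) => _ + _; apply.
Qed.

Lemma iso_dot a b q : dotv (iso_push a q) (iso_push b q) = dotv a b.
Proof.
have [_ /(_ q a b)[a' [b' []]]] := phi_iso.
have [_ <-] := is_derive_iso_x_hor a q; have [_ <-] := is_derive_iso_x_hor b q.
have [_ ->] := derive_iso_x (hvec A q a) q; have [_ ->] := derive_iso_x (hvec A
  q b) q.
by rewrite !hvecE => -> ->.
Qed.

(** The image of X_a is horizontal, and the vertical component of a horizontal vector is determined
    by its x-part. *)
Lemma iso_contact a q : dhor a iso_z q = 2^-1 * omega (iso_x q) (iso_push a q).
Proof.
have [_ /(_ q a a)[a' [b' []]]] := phi_iso.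
have [_ <-] := is_derive_iso_x_hor a q.
have [_ ->] := derive_iso_x (hvec A q a) q.
rewrite /dhor (dirderiv_val (derive_iso_z (hvec A q a) q)).
by rewrite !hvecE => ->.
Qed.

Lemma is_derive_omega (F K : G -> rV) q v dF dK :
  is_derive q v F dF -> is_derive q v K dK ->
  is_derive q v (fun y => 2^-1 * omega (F y) (K y))
    (2^-1 * (omega dF (K q) + omega (F q) dK)).
Proof.
move=> hF hK.
have h := is_derive_dotv (is_derive_mulmx A hF) hK.
apply: (is_derive_eq (is_derive_prod (is_derive_cst (2^-1 : R) q v) h)).
by rewrite mul0r add0r.
Qed.

Definition iso_push_hor (a b : rV) (q : G) : rV := \row_i dhor a (dhor b
  (iso_coord i)) q.

Lemma iso_push_hor_bracket a b q : iso_push_hor a b q - iso_push_hor b a q =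
  omega a b *: iso_vert q.
Proof.
by apply/rowP => i; rewrite !mxE -dhor_bracket//; exact: C2_iso_coord.
Qed.

(* The factor c with phi^* omega = c omega, read off from [X_a, X_b]. *)
Definition iso_factor (q : G) : R := dvert iso_z q - 2^-1 * omega (iso_x q)
  (iso_vert q).

Lemma iso_z_hor_hor a b q : dhor a (dhor b iso_z) q =
  2^-1 * (omega (iso_push a q) (iso_push b q) + omega (iso_x q) (iso_push_hor a
    b q)).
Proof.
have -> : dhor b iso_z = fun y => 2^-1 * omega (iso_x y) (iso_push b y).
  by apply/funext => y; exact: iso_contact.
rewrite [LHS]/dhor; apply: dirderiv_val.
exact: is_derive_omega (is_derive_iso_x_hor a q) (is_derive_iso_push b (hvec A
  q a) q).
Qed.

(** Apply [X_a, X_b] = omega(a, b) Z to [iso_z], whose horizontal derivatives are known from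
    [iso_contact]; the second derivatives of [iso_x] recombine through the same bracket into
    [iso_vert]. *)
Lemma iso_conformal a b q : omega (iso_push a q) (iso_push b q) = iso_factor q
  * omega a b.
Proof.
have := dhor_bracket a b q C2_iso_z; rewrite !iso_z_hor_hor.
have : omega (iso_x q) (iso_push_hor a b q) - omega (iso_x q) (iso_push_hor b a
  q) =
    omega a b * omega (iso_x q) (iso_vert q).
  by rewrite -omegaBr iso_push_hor_bracket omegaZr.
rewrite (omegaC (iso_push b q)) /iso_factor.
move: (dvert iso_z q) (omega (iso_x q) (iso_push_hor a b q)) (omega (iso_x q)
  (iso_push_hor b a q)) => T1 T2 T3.
move: (omega (iso_x q) (iso_vert q)) (omega (iso_push a q) (iso_push b q))
  (omega a b) => T4 T5 T6.
move=> e1 e2; have -> : T5 = T6 * T1 - 2^-1 * (T2 - T3) by rewrite -e2; field.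
by rewrite e1; ring.
Qed.

Definition iso_mx (q : G) : 'M[R]_(2 * n) := \matrix_i iso_push (delta_mx 0 i)
  q.

Lemma iso_push_mul a q : iso_push a q = a *m iso_mx q.
Proof.
have dF i : differentiable (iso_coord i) q by case: (C2_iso_coord i).
apply/rowP => i; rewrite !mxE [LHS]/dhor.
rewrite {1}[a]row_sum_delta.
have -> : hvec A q (\sum_j a 0 j *: delta_mx 0 j) =
    \sum_j a 0 j *: hvec A q (delta_mx 0 j).
  rewrite -row_sum_delta /hvec; apply: eq_bigr => j _; congr (_ *: _).
  rewrite (bigD1 j)//= mxE !eqxx scale1r big1 ?addr0// => l lj.
  by rewrite mxE (negPf lj) andbF scale0r.
rewrite dirderivE deriveE// linear_sum; apply: eq_bigr => j _.
by rewrite linearZ !mxE /dhor dirderivE deriveE.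
Qed.

Lemma iso_mx_orth q : iso_mx q *m (iso_mx q)^T = 1%:M.
Proof.
apply/matrixP => i j; rewrite !mxE.
transitivity (dotv (delta_mx 0 i : rV) (delta_mx 0 j)).
  rewrite -(iso_dot _ _ q); apply: eq_bigr => l _.
  by rewrite !mxE.
by rewrite dotvE trmx_delta mul_delta_mx_cond mulmxnE mxE !eqxx.
Qed.

Lemma iso_mx_omega q : iso_mx q *m A *m (iso_mx q)^T = iso_factor q *: A.
Proof.
have e (B : 'M[R]_(2 * n)) i j : B i j = dotv (delta_mx 0 i *m B) (delta_mx 0
  j).
  by rewrite dotvE -rowE trmx_delta -colE !mxE.
apply/matrixP => i j; rewrite [in RHS]mxE !e -[in RHS]/(omega _ _)
  -iso_conformal.
by rewrite /omega !iso_push_mul !mulmxA [RHS]dotvC [RHS]dotvMl dotvC.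
Qed.

Lemma iso_mx_orthC q : (iso_mx q)^T *m iso_mx q = 1%:M.
Proof. exact/mulmx1C/iso_mx_orth. Qed.

Lemma iso_mx_mulA q : iso_mx q *m A = iso_factor q *: (A *m iso_mx q).
Proof.
by rewrite scalemxAl -iso_mx_omega -!mulmxA iso_mx_orthC mulmx1.
Qed.

Section Nontrivial.
Hypothesis A_neq0 : A != 0.

(** Squaring M A M^T = c A with M orthogonal and taking traces gives tr(A^2) = c^2 tr(A^2), where
    tr(A^T A) is nonzero. *)
Lemma iso_factor_sqr q : iso_factor q * iso_factor q = 1.
Proof.
have trS : \tr (A^T *m A) != 0.
  apply: contra A_neq0 => /eqP tr0; apply/eqP/matrixP => i j.
  have ge0 (l : 'I_(2 * n)) : 0 <= (A^T *m A) l l.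
    by rewrite mxE sumr_ge0// => m _; rewrite mxE -expr2 sqr_ge0.
  have Sj : (A^T *m A) j j = 0 by apply: (psumr_eq0P (fun l _ => ge0 l) tr0).
  rewrite mxE in Sj.
  have sq (l : 'I_(2 * n)) : true -> 0 <= A^T j l * A l j.
    by rewrite mxE -expr2 sqr_ge0.
  have /eqP : A^T j i * A i j = 0 by apply: (psumr_eq0P sq Sj).
  by rewrite !mxE mulf_eq0 orbb => /eqP.
have e : iso_mx q *m (A *m A) *m (iso_mx q)^T = (iso_factor q * iso_factor q)
  *: (A *m A).
  rewrite -scalerA scalemxAl -{1}iso_mx_omega scalemxAr -{1}iso_mx_omega.
  rewrite -!mulmxA; congr (_ *m (_ *m _)).
  by rewrite !mulmxA iso_mx_orthC mul1mx.
have {e} : \tr (A^T *m A) = iso_factor q * iso_factor q * \tr (A^T *m A).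
  rewrite gramE !linearN/= mulrN -[in RHS]linearZ/= -e [in RHS]mxtrace_mulC.
  by rewrite (mulmxA (iso_mx q)^T) iso_mx_orthC mul1mx.
by move/(congr1 (fun x => x / \tr (A^T *m A))); rewrite mulfK// divff.
Qed.

Definition iso_vert_hor a q : rV := \row_i dhor a (dvert (iso_coord i)) q.

(** This is X_a c = 0 written out for c = [iso_factor]: since c^2 is constantly 1, 2 c X_a c = 0. *)
Lemma iso_factor_dhor a q :
  dhor a (dvert iso_z) q = 2^-1 * (omega (iso_push a q) (iso_vert q) + omega
    (iso_x q) (iso_vert_hor a q)).
Proof.
have [_ ddz _] := C2_iso_z.
have h1 := is_derive_dirderiv (hvec A q a) (ddz evert q).
have h2 := is_derive_omega (is_derive_iso_x_hor a q) (is_derive_iso_vert (hvec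
  A q a) q).
have h := is_deriveB h1 h2.
have := is_derive_prod h h.
have -> : (fun y => ((dvert iso_z - (fun y =>
  2^-1 * omega (iso_x y) (iso_vert y))) y *
            (dvert iso_z - (fun y => 2^-1 * omega (iso_x y) (iso_vert y))) y))
              = cst 1.
  by apply/funext => y; exact: iso_factor_sqr.
move=> [_]; rewrite derive_cst.
rewrite -[(dvert iso_z - _) q]/(iso_factor q) -[dirderiv _ _ q]/(dhor a (dvert
  iso_z) q).
rewrite -[\row_i _]/(iso_vert_hor a q).
set d := dhor a (dvert iso_z) q - _ => e.
have {}e : 2 * iso_factor q * d = 0 by rewrite e; ring.
apply/eqP; rewrite -subr_eq0 -/d; apply/eqP.
have c0 : 2 * iso_factor q != 0.
  rewrite mulf_neq0// ?pnatr_eq0//; apply/eqP => c0.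
  by have := iso_factor_sqr q; rewrite c0 mulr0 => /eqP;
    rewrite eq_sym oner_eq0.
by apply: (mulfI c0); rewrite e mulr0.
Qed.

(** Z X_a and X_a Z agree on [iso_z]. Computing the first from [iso_contact] and the second from
    [iso_factor_dhor] leaves omega(Z x, X_a x) = 0 with x = [iso_x]; the vectors X_a x span and
    [omega] is non-degenerate. *)
Lemma iso_vert0 q : iso_vert q = 0.
Proof.
have h a : omega (iso_vert q) (iso_push a q) = 0.
  have e1 : dvert (dhor a iso_z) q = 2^-1 * (omega (iso_vert q) (iso_push a q)
    + omega (iso_x q) (iso_vert_hor a q)).
    have -> : dhor a iso_z = fun y => 2^-1 * omega (iso_x y) (iso_push a y).
      by apply/funext => y; exact: iso_contact.
    apply: dirderiv_val.
    have -> : iso_vert_hor a q = \row_i dirderiv evert (dhor a (iso_coord i)) q.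
      by apply/rowP => i; rewrite !mxE -dvert_dhor//; exact: C2_iso_coord.
    exact: is_derive_omega (is_derive_iso_x_vert q) (is_derive_iso_push a evert
      q).
  have := iso_factor_dhor a q; rewrite -dvert_dhor; last exact: C2_iso_z.
  rewrite e1 (omegaC (iso_push a q)).
  move: (omega (iso_vert q) (iso_push a q)) (omega (iso_x q) (iso_vert_hor a
    q)) => x y e.
  lra.
apply: A_inj; apply/eqP; rewrite -normv2_eq0.
have := h (iso_vert q *m A *m (iso_mx q)^T); rewrite /omega iso_push_mul
  -mulmxA iso_mx_orthC mulmx1.
by move=> /eqP.
Qed.

Lemma iso_push_hor_sym a b q : iso_push_hor a b q = iso_push_hor b a q.
Proof.
by apply/eqP; rewrite -subr_eq0 iso_push_hor_bracket iso_vert0 scaler0.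
Qed.

(** X_c is applied to the constant scalar product of the pushed vectors. *)
Lemma iso_push_hor_skew a b c q :
  dotv (iso_push_hor c a q) (iso_push b q) = - dotv (iso_push_hor c b q)
    (iso_push a q).
Proof.
have := is_derive_dotv (is_derive_iso_push a (hvec A q c) q)
  (is_derive_iso_push b (hvec A q c) q).
have -> : (fun y => dotv (iso_push a y) (iso_push b y)) = cst (dotv a b).
  by apply/funext => y; exact: iso_dot.
move=> [_]; rewrite derive_cst -/(iso_push_hor c a q) -/(iso_push_hor c b q)
  (dotvC (iso_push a q)).
move: (dotv (iso_push_hor c a q) (iso_push b q)) (dotv (iso_push_hor c b q)
  (iso_push a q)) => x y e.
lra.
Qed.

(* A trilinear form symmetric in two slots and skew in two others vanishes. *)
Lemma iso_push_hor0 a b q : iso_push_hor a b q = 0.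
Proof.
have h c : dotv (iso_push_hor a b q) (iso_push c q) = 0.
  have : dotv (iso_push_hor a b q) (iso_push c q) = - dotv (iso_push_hor a b q)
    (iso_push c q).
    rewrite {1}iso_push_hor_skew iso_push_hor_sym iso_push_hor_skew opprK
      iso_push_hor_sym iso_push_hor_skew.
    by rewrite iso_push_hor_sym.
  by move: (dotv _ _) => x; lra.
apply: dotv_inj => w; rewrite dot0v -(h (w *m (iso_mx q)^T)).
by rewrite iso_push_mul -mulmxA iso_mx_orthC mulmx1.
Qed.

Lemma lift_coef_differentiable a q : differentiable (lift_coef a) q.
Proof.
have -> : lift_coef a = (2^-1 : R) *: (fun y : G =>
  \sum_i (y.1 0 i * a 0 i)) \o rot A.
  by apply/funext.
have -> : (fun y : G => \sum_i y.1 0 i * a 0 i) =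
    \sum_i ((fun y : G => y.1 0 i) * cst (a 0 i)).
  by apply/funext => y; rewrite fct_sumE.
apply/differentiableZ/differentiable_comp; first exact: rot_differentiable.
apply: differentiable_sum => i; apply: differentiableM => //.
apply: (@differentiable_comp _ _ _ _ fst (fun x : rV => x 0 i)).
  by apply: linear_differentiable => y; exact: cvg_fst.
exact: differentiable_coord.
Qed.

Lemma is_derive_curve (F : G -> R) (c : R -> G) t dc :
  differentiable F (c t) -> is_derive t (1 : R) c dc ->
  is_derive t (1 : R) (fun s => F (c s)) (dirderiv dc F (c t)).
Proof.
move=> dF [dct cE].
have ddc : differentiable c t by exact/derivable1_diffP.
have dFc : differentiable (F \o c) t by exact: differentiable_comp.
apply: DeriveDef; first exact: diff_derivable.
rewrite deriveE// diff_comp//= dirderivE deriveE//.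
by rewrite -cE deriveE.
Qed.

Lemma is_derive_geo u l t : is_derive t (1 : R)
  (fun s => (geo_x u l s, geo_z u l s) : G)
  (hvec A (geo_x u l t, geo_z u l t) (geo_h u l t)).
Proof.
apply/is_derive_pairP; rewrite hvecE/=; split; first exact: is_derive_geo_x.
by rewrite dotvC; exact: is_derive_geo_z.
Qed.

(** The velocity of a geodesic is horizontal, and the horizontal derivatives of [iso_mx] are the
    vanishing X_b X_a of the coordinates. *)
Lemma iso_mx_geo u l t :
  iso_mx (geo_x u l t, geo_z u l t) = iso_mx (geo_x u l 0, geo_z u l 0).
Proof.
apply/matrixP => i j; rewrite !mxE.
apply: (@is_derive_0_is_cst _
  (fun s => dhor (delta_mx 0 i) (iso_coord j) (geo_x u l s, geo_z u l s))) => s.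
pose c' s : G := (geo_x u l s, geo_z u l s).
have dX : differentiable (dhor (delta_mx 0 i) (iso_coord j)) (c' s).
  have [d1 d2 _] := C2_iso_coord j.
  have -> : dhor (delta_mx 0 i) (iso_coord j) = (fun y =>
    dirderiv (ehor (delta_mx 0 i)) (iso_coord j) y)
     + lift_coef (delta_mx 0 i) * dvert (iso_coord j).
    by apply/funext => y; rewrite dhorE.
  apply: differentiableD; first exact: d2.
  apply: differentiableM; last exact: d2.
  exact: lift_coef_differentiable.
have := iso_push_hor0 (geo_h u l s) (delta_mx 0 i) (c' s).
move=> /rowP/(_ j); rewrite [LHS]mxE [RHS]mxE => e.
exact: is_derive_eq (is_derive_curve dX (is_derive_geo u l s)) e.
Qed.

End Nontrivial.
End Isometry.

(** * Invariants of isometrically equivalent geodesics *)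

Lemma normv2_geo_h u l t j : normv2 (geo_h u l t).{j} = normv2 u.{j}.
Proof.
rewrite /normv2 geo_h_proj dotv_proj_plane.
set c := cos _; set s := sin _.
have cs : c ^+ 2 + s ^+ 2 = 1 by exact: cos2Dsin2.
rewrite (_ : _ + _ = c ^+ 2 + s ^+ 2); first by rewrite cs mul1r.
by have a0 := alpha_neq0 j; field.
Qed.

Lemma is_derive_unique_near (m : nat) (F K : R -> 'rV[R]_m) (t : R) dF dK :
  is_derive t (1 : R) F dF -> is_derive t (1 : R) K dK ->
  (\forall s \near t, F s = K s) -> dF = dK.
Proof.
move=> [_ <-] [_ <-] h; exact: near_eq_derive.
Qed.

(** Differentiating the equality of curves gives h1 = h2 M with M constant, orthogonal and commuting
    with A^T A, hence equal block norms. A second derivative together with M A = c A M gives l1 = c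
    l2. *)
Lemma iso_equiv_invariants u1 u2 l1 l2 : u1 != 0 ->
  iso_equiv A (u1, l1) (u2, l2) ->
  (forall j, normv2 u1.{j} = normv2 u2.{j}) /\ (l1 = l2 \/ l1 = - l2).
Proof.
move=> u1n0 [phi [phi_iso _ geq]].
have A_neq0 : A != 0.
  by apply: contra u1n0 => /eqP A0; apply/eqP/A_inj; rewrite A0 mulmx0.
pose c2 t : G := (geo_x u2 l2 t, geo_z u2 l2 t).
pose M := iso_mx phi (c2 0); pose c := iso_factor phi (c2 0).
have MM : M *m M^T = 1%:M by exact: iso_mx_orth.
have MA : M *m A = c *: (A *m M) by exact: iso_mx_mulA.
have cc : c * c = 1 by exact: iso_factor_sqr.
have xeq t : 0 <= t <= 1 -> geo_x u1 l1 t = iso_x phi (c2 t).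
  by move=> /geq; rewrite !geodesicE => /(congr1 fst).
(* The curves are compared on [0, 1] only, so two-sided derivatives are taken at interior times,
   eventually at 1/2. *)
have near01 (P : R -> Prop) (t : R) : 0 < t < 1 -> (forall s : R,
  0 < s < 1 -> P s) ->
    \forall s \near t, P s.
  move=> t01 PP; have : \forall s \near t, s \in `](0 : R), 1[.
    by apply: near_in_itvoo; rewrite in_itv.
  by apply: filterS => s; rewrite in_itv/=; exact: PP.
have heq t : 0 < t < 1 -> geo_h u1 l1 t = geo_h u2 l2 t *m M.
  move=> t01; rewrite /M -(iso_mx_geo phi_iso A_neq0 u2 l2 t) -iso_push_mul//.
  apply: (is_derive_unique_near (is_derive_geo_x u1 l1 t)
     (K := fun s => iso_x phi (c2 s))).
    apply/is_derive_rVP => i; rewrite mxE.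
    apply: (is_derive_curve (F := iso_coord phi i) (c := c2));
      last exact: is_derive_geo.
    by case: (C2_iso_coord phi_iso i).
  by apply: near01 t01 _ => s /andP[s0 s1]; apply: xeq; rewrite !ltW.
have half : 0 < (2^-1 : R) < 1 by apply/andP; split; lra.
have MS : comm_mx M (A^T *m A).
  rewrite /comm_mx gramE mulmxN mulNmx; congr (- _).
  rewrite mulmxA MA -scalemxAl -mulmxA MA -scalemxAr scalerA cc scale1r.
  exact: mulmxA.
split=> [j|].
  rewrite -(normv2_geo_h u1 l1 2^-1) heq// -(normv2_geo_h u2 l2 2^-1).
  move: (geo_h _ _ _) => h; rewrite [in LHS]sv_projE -mulmxA.
  rewrite (sv_mx_comm j MS : M *m _ = _) mulmxA -sv_projE.
  by rewrite /normv2 dotvMl -mulmxA MM mulmx1.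
have h1n0 : geo_h u1 l1 2^-1 *m A != 0.
  apply: contra u1n0 => /eqP /A_inj h0; rewrite [u1]sv_proj_decomp big1// =>
    j _.
  apply/eqP; rewrite -normv2_eq0 -(normv2_geo_h u1 l1 2^-1) h0 sv_projE mul0mx.
  by rewrite normv20.
have : l1 *: (geo_h u1 l1 2^-1 *m A) = l2 *: (geo_h u2 l2 2^-1 *m A) *m M.
  apply: (is_derive_unique_near (is_derive_geo_h u1 l1 2^-1)
    (is_derive_mulmx M (is_derive_geo_h u2 l2 2^-1))).
  exact: near01 half _.
have -> : l2 *: (geo_h u2 l2 2^-1 *m A) *m M =
    (l2 * c) *: (geo_h u1 l1 2^-1 *m A).
  rewrite heq// -scalemxAl -!mulmxA MA -scalemxAr scalerA -mulrA cc mulr1.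
  by [].
move=> /eqP; rewrite -subr_eq0 -scalerBl scaler_eq0 (negPf h1n0) orbF subr_eq0.
move=> /eqP ->.
have : (c - 1) * (c + 1) == 0 by apply/eqP; transitivity (c * c - 1);
  [ring|rewrite cc subrr].
rewrite mulf_eq0 subr_eq0 addr_eq0 => /orP[]/eqP ->; [left|right]; ring.
Qed.

(** * Description of [Gamma_inf] *)

Section FixedEndpoint.
Variable p : G.
Local Notation x := p.1.
Local Notation z := p.2.
Local Notation I0p := (I0 A alpha p.1).

(* The factor by which the end point map multiplies |u_j|^2. *)
Definition x_gain (l : R) (j : 'I_k) : R := x_coef_u l j 1 ^+ 2 + alpha j ^+ 2
  * x_coef_uA l j 1 ^+ 2.

Lemma normv2_geo_x u l j : normv2 (geo_x u l 1).{j} = x_gain l j * normv2 u.{j}.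
Proof. by rewrite /normv2 geo_x_proj dotv_proj_plane /x_gain; congr (_ * _);
  ring. Qed.

Lemma in_L l j : l != 0 -> (j \in L alpha l) = (sin (l * alpha j / 2) == 0).
Proof.
move=> l0; have a0 := alpha_neq0 j; rewrite inE; apply/asboolP/eqP.
  move=> [m [lE _]]; apply/sin_eq0P; exists m.
  by rewrite lE; field.
move=> /sin_eq0P[m mE]; exists m; split; last exact/eqP.
have -> : l = l * alpha j / 2 * (2 / alpha j) by field.
by rewrite mE; ring.
Qed.

Lemma L_neq0 l j : j \in L alpha l -> l != 0.
Proof. by rewrite inE => /asboolP[m [_ /eqP]]. Qed.

Lemma LambdaP l : Lambda alpha l <-> exists j, j \in L alpha l.
Proof.
split=> [[j _ jl]|[j]]; first by exists j; rewrite inE; exact/asboolP.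
by rewrite inE => /asboolP jl; exists j.
Qed.

Lemma x_gainE l j : l != 0 ->
  x_gain l j = 4 * sin (l * alpha j / 2) ^+ 2 / (l * alpha j) ^+ 2.
Proof.
move=> l0; have a0 := alpha_neq0 j; rewrite /x_gain /x_coef_u /x_coef_uA (negPf
  l0) mulr1.
rewrite cos_half sin_half; set s := sin _; set c := cos _.
have cs : c ^+ 2 = 1 - s ^+ 2 by exact: cos2sin2.
transitivity ((4 * c ^+ 2 * s ^+ 2 + 4 * s ^+ 4) / (l * alpha j) ^+ 2).
  by field; rewrite l0 a0.
by rewrite cs; field; rewrite l0 a0.
Qed.

(** The blocks in [L] are the resonant ones: there the trajectory is back at 0 at time 1, whatever
    u_j is. *)
Lemma x_gain_eq0 l j : (x_gain l j == 0) = (j \in L alpha l).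
Proof.
have [l0|l0] := eqVneq l 0.
  rewrite /x_gain /x_coef_u /x_coef_uA l0 eqxx expr1n expr0n mulr0 addr0
    oner_eq0; apply/esym/negP.
  by move=> /L_neq0; rewrite eqxx.
have a0 := alpha_neq0 j.
rewrite in_L// x_gainE// !(mulf_eq0, invr_eq0, sqrf_eq0) (negPf l0) (negPf a0).
by rewrite pnatr_eq0 /= !orbF orbb.
Qed.

Lemma x_coef_u_L l j : j \in L alpha l -> x_coef_u l j 1 = 0.
Proof.
move=> jL; have l0 := L_neq0 jL; move: jL; rewrite in_L// => /eqP s0.
by rewrite /x_coef_u (negPf l0) mulr1 sin_half s0 !mulr0 mul0r.
Qed.

Lemma x_coef_uA_L l j : j \in L alpha l -> x_coef_uA l j 1 = 0.
Proof.
move=> jL; have l0 := L_neq0 jL; move: jL; rewrite in_L// => /eqP s0.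
by rewrite /x_coef_uA (negPf l0) mulr1 cos_half s0 expr0n mulr0 subr0 subrr
  mul0r.
Qed.

Lemma z_coef_L l j : j \in L alpha l -> z_coef l j 1 = (2 * l)^-1.
Proof.
move=> jL; have l0 := L_neq0 jL; move: jL; rewrite in_L// => /eqP s0.
have a0 := alpha_neq0 j.
by rewrite /z_coef (negPf l0) mulr1 sin_half s0 !mulr0 subr0; field;
  rewrite l0 a0.
Qed.

(** The real-valued g, equal to 0 at the poles because the inverse of 0 is 0. *)
Definition g_finite (y : R) : R := 8^-1 * ((y - sin y) / sin (y / 2) ^+ 2).

(** The origin of g: it measures the height gained per |x_j|^2, whereas [z_coef] measures it per
    |u_j|^2. *)
Lemma z_coef_notL l j : l != 0 -> j \notin L alpha l ->
  z_coef l j 1 = alpha j * g_finite (l * alpha j) * x_gain l j.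
Proof.
move=> l0; rewrite in_L// => s0; have a0 := alpha_neq0 j.
by rewrite x_gainE// /z_coef (negPf l0) mulr1 /g_finite; field;
  rewrite l0 a0 s0.
Qed.

Lemma gfun_notL l j : l != 0 -> j \notin L alpha l ->
  gfun (l * alpha j) = (g_finite (l * alpha j))%:E.
Proof.
move=> l0; rewrite in_L// => s0.
by rewrite /gfun mulf_eq0 (negPf l0) (negPf (alpha_neq0 j)) (negPf s0).
Qed.

Lemma gfun_L l j : j \in L alpha l ->
  gfun (l * alpha j) = if 0 < l then +oo%E else -oo%E.
Proof.
move=> jL; have l0 := L_neq0 jL; move: jL; rewrite in_L// => /eqP s0.
rewrite /gfun mulf_eq0 (negPf l0) (negPf (alpha_neq0 j)) s0 eqxx.
by rewrite pmulr_lgt0// alpha_gt0.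
Qed.

Definition z_defect (l : R) : R :=
  z - \sum_(j in ~: I0p) alpha j * g_finite (l * alpha j) * normv2 x.{j}.

(** The constant C(l): each resonant block contributes |u_j|^2 / (2 l) to the height, and together
    they must supply [z_defect]. *)
Definition radius2 (l : R) : R := 2 * l * z_defect l.

Lemma in_I0 j : (j \in I0p) = (x.{j} == 0).
Proof. by rewrite inE. Qed.

(** If [L] lies in [I0], no pole enters the sum and the condition is real. Otherwise the sum is
    infinite with the sign of [l], and the product with [l] is [-oo]. *)
Lemma Lambda_pP l : Lambda_p A alpha p l <->
  [/\ Lambda alpha l, L alpha l \subset I0p & 0 < radius2 l].
Proof.
rewrite /Lambda_p/=.
have [/fintype.subsetP LI|] := boolP (L alpha l \subset I0p).
  suff e : l != 0 -> ((z%:E - \sum_(j in ~: I0p)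
            (alpha j)%:E * gfun (l * alpha j) * (normv2 x.{j})%:E) * l%:E)%E =
      (z_defect l * l)%:E.
    split=> [[Ll]|[Ll _ C0]]; have /LambdaP[j /L_neq0 l0] := Ll.
      by rewrite e// lte_fin => h; split => //; rewrite /radius2; nra.
    by split => //; rewrite e// lte_fin; move: C0; rewrite /radius2; nra.
  move=> l0; rewrite (eq_bigr (fun j =>
    (alpha j * g_finite (l * alpha j) * normv2 x.{j})%:E)) ?sumEFin// => j.
  rewrite finset.in_setC => jI; rewrite gfun_notL//.
  by apply: contra jI; exact: LI.
move=> /fintype.subsetPn[j jL jI]; split=> [[Ll]|[]//].
have nx : 0 < normv2 x.{j} by rewrite normv2_gt0 -in_I0.
have l0 := L_neq0 jL.
have term i : i \in ~: I0p -> i \in L alpha l ->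
  ((alpha i)%:E * gfun (l * alpha i)
   * (normv2 x.{i})%:E = if (0 < l)%R then +oo else -oo)%E.
  rewrite finset.in_setC in_I0 -normv2_gt0 => ni iL; rewrite gfun_L//.
  by case: ifP => _; rewrite ?(gt0_muley, gt0_muleNy, gt0_mulye,
    gt0_mulNye) ?lte_fin ?alpha_gt0.
have [lpos|lneg] := ltP 0 l.
  have -> : (\sum_(j in ~: I0p)
     (alpha j)%:E * gfun (l * alpha j) * (normv2 x.{j})%:E = +oo)%E.
    (* In extended sums [-oo] absorbs [+oo], so for positive [l] no summand may be [-oo]; for
       negative [l] a single infinite summand settles the sum. *)
    apply/esum_eqyP => [i iI|]; last first.
      by exists j; rewrite mem_index_enum finset.in_setC jI term
        ?finset.in_setC ?jI// lpos.
    have [iL|iL] := boolP (i \in L alpha l); first by rewrite term// lpos.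
    by rewrite gfun_notL.
  by rewrite addeNy gt0_mulNye ?lte_fin// ltxx.
have {}lneg : l < 0 by rewrite lt_def eq_sym l0.
have -> : (\sum_(j in ~: I0p)
   (alpha j)%:E * gfun (l * alpha j) * (normv2 x.{j})%:E = -oo)%E.
  apply/esum_eqNyP; exists j.
  by rewrite mem_index_enum finset.in_setC jI term ?finset.in_setC ?jI// ltNge
    ltW.
by rewrite addey// lt0_mulye ?lte_fin// ltxx.
Qed.

(* The inverse of s + c A on the eigenspace of alpha_j is
   (s - c A) / (s^2 + alpha_j^2 c^2). *)
Definition fixed_part (l : R) : rV := \sum_(j in ~: I0p)
  (x_gain l j)^-1 *: (x_coef_u l j 1 *: x.{j} - x_coef_uA l j 1 *: (x.{j} *m
    A)).

Lemma fixed_part_proj l j : (fixed_part l).{j} =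
  if j \in I0p then 0
  else (x_gain l j)^-1 *: (x_coef_u l j 1 *: x.{j} - x_coef_uA l j 1 *: (x.{j}
    *m A)).
Proof.
have e0 i (a b c : R) : (a *: (b *: x.{i} - c *: (x.{i} *m A))).{j} =
    if i == j then a *: (b *: x.{i} - c *: (x.{i} *m A)) else 0.
  rewrite sv_projZ -scaleNr sv_projD !sv_projZ sv_projA sv_proj_proj.
  by case: eqP => //; rewrite mul0mx !scaler0 addr0 scaler0.
have e i : ((x_gain l i)^-1 *: (x_coef_u l i 1 *: x.{i} - x_coef_uA l i 1 *:
  (x.{i} *m A))).{j} =
   if i == j then (x_gain l j)^-1 *: (x_coef_u l j 1 *: x.{j} - x_coef_uA l j 1
     *: (x.{j} *m A)) else 0.
  by rewrite e0; case: eqP => [->|_]; reflexivity.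
rewrite /fixed_part sv_proj_sum; under eq_bigr do rewrite e.
case: ifPn => jI.
  by rewrite big1// => i; rewrite finset.in_setC => iI; case: eqP => // ij;
    rewrite ij jI in iI.
rewrite (bigD1 j) ?finset.in_setC//= eqxx big1 ?addr0// => i /andP[_ /negPf ->].
by [].
Qed.

Lemma geo_x_eq u l : geo_x u l 1 = x <->
  forall j, x_coef_u l j 1 *: u.{j} + x_coef_uA l j 1 *: (u.{j} *m A) = x.{j}.
Proof.
split=> [<- j|h]; first by rewrite geo_x_proj.
rewrite [LHS]sv_proj_decomp [RHS]sv_proj_decomp; apply: eq_bigr => j _.
by rewrite geo_x_proj h.
Qed.

Lemma geo_x_eq_inv u l j : j \notin L alpha l ->
  x_coef_u l j 1 *: u.{j} + x_coef_uA l j 1 *: (u.{j} *m A) = x.{j} <-> u.{j} =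
    (fixed_part l).{j}.
Proof.
rewrite -x_gain_eq0 => N0.
have NE : x_coef_u l j 1 ^+ 2 + alpha j ^+ 2 * x_coef_uA l j 1 ^+ 2 = x_gain l
  j by [].
have bE : (fixed_part l).{j} =
    (x_gain l j)^-1 *: (x_coef_u l j 1 *: x.{j} - x_coef_uA l j 1 *: (x.{j} *m
      A)).
  rewrite fixed_part_proj; case: ifPn => //; rewrite in_I0 => /eqP ->.
  by rewrite mul0mx !scaler0 subrr scaler0.
have AAu := sv_projAA u j; have AAx := sv_projAA x j.
rewrite bE; move: (x_coef_u l j 1) (x_coef_uA l j 1) NE => s c NE.
move: (u.{j}) (x.{j}) AAu AAx => y w yAA wAA.
move: (x_gain l j) NE N0 => N NE N0; split=> [<-|->].
  rewrite mulmxDl -2!scalemxAl yAA; apply/rowP => i; rewrite !mxE.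
  move: (y 0 i) (\sum_(_ < _) _) => a b.
  by rewrite -NE; move: N0; rewrite -NE => N0; field; rewrite exprMn.
rewrite -scalemxAl mulmxBl -2!scalemxAl wAA; apply/rowP => i; rewrite !mxE.
move: (w 0 i) (\sum_(_ < _) _) => a b.
by rewrite -NE; move: N0; rewrite -NE => N0; field; rewrite exprMn.
Qed.

(** Three kinds of blocks: resonant ones, non-resonant ones with nonzero x_j, which give the
    g-terms, and non-resonant ones in [I0], where u_j = 0. *)
Lemma geo_zE u l : l != 0 -> L alpha l \subset I0p -> geo_x u l 1 = x ->
  geo_z u l 1 = (2 * l)^-1 * \sum_(j in L alpha l) normv2 u.{j} + (z - z_defect
    l).
Proof.
move=> l0 /fintype.subsetP LI xE; rewrite /geo_z (bigID (mem (L alpha l)))/=;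
  congr (_ + _).
  by rewrite mulr_sumr; apply: eq_bigr => j jL; rewrite z_coef_L.
rewrite /z_defect opprB addrCA subrr addr0.
rewrite [RHS](bigID (mem (L alpha l)))/= [X in _ = X + _]big1 ?add0r;
  last first.
  by move=> j /andP[]; rewrite finset.in_setC => /negP jI /LI.
rewrite [LHS](bigID (mem I0p))/= [X in X + _ = _]big1 ?add0r =>
  [|j /andP[jL jI]].
  apply: eq_big => [j|j /andP[jL jI]]; first by rewrite finset.in_setC andbC.
  by rewrite z_coef_notL// -xE normv2_geo_x; ring.
have /eqP : normv2 (geo_x u l 1).{j} = 0.
  by rewrite xE; move: jI; rewrite in_I0 => /eqP ->; rewrite normv20.
by rewrite normv2_geo_x mulf_eq0 x_gain_eq0 (negPf jL) => /eqP ->;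
  rewrite mulr0.
Qed.

Lemma GammaE u l : Gamma A p (u, l) <-> geo_x u l 1 = x /\ geo_z u l 1 = z.
Proof.
rewrite /Gamma/= /Exp geodesicE [p in _ = p]surjective_pairing.
by split=> [[<- <-]//|[-> ->]].
Qed.

(** Outside [Gamma0] some nonzero u_j has x_j = 0, so j is resonant and [l] is in Lambda.
    Conversely, resonant u_j do not affect x, the equation on their norms is the height equation,
    and a positive radius excludes [Gamma0]. *)
Lemma Gamma_infP u l : Gamma_inf A alpha p (u, l) <->
  [/\ Lambda_p A alpha p l, forall j, j \notin L alpha l ->
    u.{j} = (fixed_part l).{j} &
      \sum_(j in L alpha l) normv2 u.{j} = radius2 l].
Proof.
split.
  move=> [Gp nG0]; have /GammaE[xE zE] := Gp.
  have [j jI uj0] : exists2 j, j \in I0p & u.{j} != 0.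
    apply: contrapT => h; apply: nG0; split => //=; apply: big1 => j jI.
    apply/eqP; rewrite normv2_eq0; apply: contrapT => uj0.
    by apply: h; exists j => //; apply/negP.
  have jL : j \in L alpha l.
    rewrite -x_gain_eq0; have /eqP : x_gain l j * normv2 u.{j} = 0.
      by rewrite -normv2_geo_x xE; move: jI; rewrite in_I0 => /eqP ->;
        rewrite normv20.
    by rewrite mulf_eq0 normv2_eq0 (negPf uj0) orbF.
  have l0 := L_neq0 jL.
  have LI : L alpha l \subset I0p.
    apply/fintype.subsetP => i; rewrite -x_gain_eq0 => /eqP Ni.
    by rewrite in_I0 -normv2_eq0 -xE normv2_geo_x Ni mul0r.
  have sE : \sum_(j in L alpha l) normv2 u.{j} = radius2 l.
    move: zE; rewrite geo_zE// /radius2; move: (\sum_(_ in _) _) (z_defect l)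
      => s r h.
    have -> : r = (2 * l)^-1 * s by lra.
    by field.
  split => //; last by move=> i iL; apply/(geo_x_eq_inv u iL);
    have /geo_x_eq := xE.
  apply/Lambda_pP; split => //; first by apply/LambdaP; exists j.
  rewrite -sE (bigD1 j)//= ltr_pwDl ?normv2_gt0//.
  by apply: sumr_ge0 => i _; exact: normv2_ge0.
move=> [/Lambda_pP[/LambdaP[j jL] LI C0] ub sE].
have l0 := L_neq0 jL.
have xE : geo_x u l 1 = x.
  apply/geo_x_eq => i; have [iL|iL] := boolP (i \in L alpha l); last first.
    exact/geo_x_eq_inv/ub.
  rewrite x_coef_u_L// x_coef_uA_L// !scale0r addr0; apply/esym/eqP;
    rewrite -in_I0.
  by move/fintype.subsetP : LI; apply.
have Gp : Gamma A p (u, l).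
  apply/GammaE; split => //; rewrite geo_zE// sE /radius2.
  by field.
split => // -[_ /= s0].
have : \sum_(j in L alpha l) normv2 u.{j} <= \sum_(j in I0p) normv2 u.{j}.
  rewrite [leRHS](big_setID (L alpha l))/= (finset.setIidPr LI) lerDl.
  by apply: sumr_ge0 => i _; exact: normv2_ge0.
by rewrite s0 sE leNgt C0.
Qed.

Lemma g_finite_sign l j : 0 <= l * (alpha j * g_finite (l * alpha j)).
Proof.
have -> : l * (alpha j * g_finite (l * alpha j)) =
    8^-1 * (l * alpha j * (l * alpha j - sin (l * alpha j)))
    * (sin (l * alpha j / 2) ^+ 2)^-1 by rewrite /g_finite; ring.
apply: mulr_ge0; last by rewrite invr_ge0 sqr_ge0.
by apply: mulr_ge0; [rewrite invr_ge0|exact: mul_sub_sin_ge0].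
Qed.

(** The g-terms have the sign of [l]. Hence all elements of Lambda_p share one sign, which rules out
    l1 = - l2 for equivalent geodesics. *)
Lemma Lambda_p_sign l : Lambda_p A alpha p l -> 0 < l * z.
Proof.
move=> /Lambda_pP[_ _]; rewrite /radius2 /z_defect => C0.
have : 0 <= l * \sum_(j in ~: I0p) alpha j * g_finite (l * alpha j) * normv2
  x.{j}.
  rewrite mulr_sumr; apply: sumr_ge0 => j _.
  by rewrite mulrA mulr_ge0 ?normv2_ge0 ?g_finite_sign.
by move: (\sum_(_ in _) _) C0 => s; lra.
Qed.

Lemma Gamma_inf_neq0 u l : Gamma_inf A alpha p (u, l) -> u != 0.
Proof.
move=> /Gamma_infP[/Lambda_pP[_ _ C0] _ sE]; apply/eqP => u0.
move: C0; rewrite -sE big1 ?ltxx// => j _.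
by rewrite u0 sv_projE mul0mx normv20.
Qed.

Lemma iso_equivP (e1 e2 : G) : Gamma_inf A alpha p e1 ->
  Gamma_inf A alpha p e2 ->
  iso_equiv A e1 e2 <->
  e1.2 = e2.2 /\ forall j, j \in L alpha e1.2 ->
    normv2 e1.1.{j} = normv2 e2.1.{j}.
Proof.
case: e1 e2 => [u1 l1] [u2 l2] G1 G2 /=.
have [L1 b1 _] := (Gamma_infP u1 l1).1 G1.
have [L2 b2 _] := (Gamma_infP u2 l2).1 G2.
split=> [ie|[lE uE]].
  have [uE lE] := iso_equiv_invariants (Gamma_inf_neq0 G1) ie.
  suff ll : l1 = l2 by split.
  case: lE => // lE; have := Lambda_p_sign L1; have := Lambda_p_sign L2.
  by rewrite lE; lra.
subst l2; apply: iso_equiv_of_norms => j.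
have [jL|jL] := boolP (j \in L alpha l1); first exact: uE.
by rewrite b1// b2.
Qed.

(** * Coordinates on the spheres *)

Definition L_rank (l : R) (j : 'I_k) : 'I_(ell alpha l).-1.+1 :=
  inord (index j (enum (L alpha l))).

Section Rank.
Variables (l : R).
Hypothesis Ll : Lambda alpha l.

(** For [l] in Lambda the set [L] is nonempty, so the index type has exactly as many elements as [L]
    and [inord] never falls back on its default there. *)
Lemma ell_prednK : (ell alpha l).-1.+1 = ell alpha l.
Proof.
have /LambdaP[j jL] := Ll; rewrite prednK//.
by apply/card_gt0P; exists j.
Qed.

Lemma L_rank_inj : {in L alpha l &, injective (L_rank l)}.
Proof.
move=> i j iL jL /(congr1 val).
have h a : a \in L alpha l -> (index a (enum (L alpha l)) < (ell alpha
  l).-1.+1)%N.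
  by move=> aL; rewrite ell_prednK /ell cardE index_mem mem_enum.
rewrite /= !inordK ?h// => e.
by rewrite -(nth_index i (_ : i \in enum (L alpha l))) ?mem_enum// e nth_index
  ?mem_enum.
Qed.

Lemma L_rank_surj i : exists2 j, j \in L alpha l & L_rank l j = i.
Proof.
have /LambdaP[j0 _] := Ll.
have isz : (i < size (enum (L alpha l)))%N.
  by apply: leq_trans (ltn_ord i) _; rewrite ell_prednK /ell cardE.
exists (nth j0 (enum (L alpha l)) i).
  by rewrite -mem_enum mem_nth.
by rewrite /L_rank index_uniq ?enum_uniq// inord_val.
Qed.

Lemma sum_L_rank (F : 'I_(ell alpha l).-1.+1 -> R) :
  \sum_i F i = \sum_(j in L alpha l) F (L_rank l j).
Proof.
rewrite (partition_big (L_rank l) xpredT)//=; apply: eq_bigr => i _.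
have [j jL ji] := L_rank_surj i.
rewrite (bigD1 j) ?jL ?ji ?eqxx//= big1 ?addr0// =>
  j' /andP[/andP[j'L /eqP j'i]].
by rewrite (@L_rank_inj j' j)// ?eqxx// j'i.
Qed.
End Rank.

(** For [l] in Lambda the sum has a single term; this form avoids an inverse of [L_rank]. *)
Definition sphere_coord (l : R) (u : rV) : 'rV[R]_(ell alpha l).-1.+1 :=
  \row_i \sum_(j in L alpha l | L_rank l j == i) Num.sqrt (normv2 u.{j} /
    radius2 l).

Lemma sphere_coord_rank l u j : Lambda alpha l -> j \in L alpha l ->
  sphere_coord l u 0 (L_rank l j) = Num.sqrt (normv2 u.{j} / radius2 l).
Proof.
move=> Ll jL; rewrite mxE (bigD1 j) ?jL ?eqxx//= big1 ?addr0//.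
move=> j' /andP[/andP[j'L /eqP /(L_rank_inj Ll j'L jL) ->]].
by rewrite eqxx.
Qed.

Lemma sphere_coord_ge0 u l : Gamma_inf A alpha p (u, l) ->
  sphere_ge0 R (ell alpha l).-1 (sphere_coord l u).
Proof.
move=> /Gamma_infP[/Lambda_pP[Ll _ C0] _ sE]; split; last first.
  by move=> i; rewrite mxE sumr_ge0// => j _; rewrite sqrtr_ge0.
rewrite /normv2 /dotv sum_L_rank//.
rewrite (eq_bigr (fun j => normv2 u.{j} / radius2 l)) => [|j jL].
  by rewrite -mulr_suml sE divff// gt_eqF.
rewrite sphere_coord_rank// -expr2 sqr_sqrtr// divr_ge0 ?normv2_ge0//.
exact: ltW.
Qed.

Definition unitv (j : 'I_k) : rV := projT1 (cid (sv_unit j)).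

Lemma unitv_proj i j : (unitv i).{j} = if i == j then unitv i else 0.
Proof.
have h : (unitv i).{i} = unitv i by rewrite /unitv; case: cid => e /= [].
by rewrite -{1}h sv_proj_proj h.
Qed.

Lemma normv2_unitv j : normv2 (unitv j) = 1.
Proof. by rewrite /unitv; case: cid => e /= []. Qed.

(** A section of the class map: the resonant components get the prescribed norms along fixed
    directions. *)
Definition sphere_covector (l : R) (v : 'rV[R]_(ell alpha l).-1.+1) : rV :=
  fixed_part l + \sum_(j in L alpha l) (Num.sqrt (radius2 l) * v 0 (L_rank l
    j)) *: unitv j.

Lemma sphere_covector_proj l (v : 'rV[R]_(ell alpha l).-1.+1) j : L alpha l
  \subset I0p -> (sphere_covector v).{j} =
  if j \in L alpha l then (Num.sqrt (radius2 l) * v 0 (L_rank l j)) *: unitv j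
  else (fixed_part l).{j}.
Proof.
move=> /fintype.subsetP LI.
rewrite /sphere_covector sv_projD [X in _ + X]sv_proj_sum; case: ifPn => jL.
  rewrite fixed_part_proj LI// add0r (bigD1 j)//= big1 => [|i /andP[_ ij]].
    by rewrite sv_projZ unitv_proj eqxx addr0.
  by rewrite sv_projZ unitv_proj (negPf ij) scaler0.
rewrite big1 ?addr0// => i iL; rewrite sv_projZ unitv_proj.
by case: eqP => [ij|_]; [rewrite -ij iL in jL|rewrite scaler0].
Qed.

Lemma normv2_sphere_covector l (v : 'rV[R]_(ell alpha l).-1.+1) j : L alpha l
  \subset I0p -> 0 < radius2 l -> j \in L alpha l ->
  normv2 (sphere_covector v).{j} = radius2 l * v 0 (L_rank l j) ^+ 2.
Proof.
move=> LI C0 jL; rewrite sphere_covector_proj// jL normv2Z normv2_unitv mulr1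
  exprMn.
by rewrite sqr_sqrtr// ltW.
Qed.

Lemma sphere_covector_Gamma_inf l (v : 'rV[R]_(ell alpha l).-1.+1) : Lambda_p A
  alpha p l ->
  sphere_ge0 R (ell alpha l).-1 v -> Gamma_inf A alpha p (sphere_covector v, l).
Proof.
move=> Lp [v1 v0]; have /Lambda_pP[Ll LI C0] := Lp.
apply/Gamma_infP; split => // [j jL|].
  by rewrite sphere_covector_proj// (negPf jL).
rewrite (eq_bigr (fun j => radius2 l * v 0 (L_rank l j) ^+ 2)) => [|j jL].
  rewrite -mulr_sumr (_ : \sum_(_ in _) _ = 1) ?mulr1//.
  apply: etrans v1; rewrite /normv2 /dotv [RHS](sum_L_rank Ll).
  by apply: eq_bigr => j _; rewrite expr2.
exact: normv2_sphere_covector.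
Qed.

Lemma sphere_coordK l (v : 'rV[R]_(ell alpha l).-1.+1) : Lambda_p A alpha p l ->
  sphere_ge0 R (ell alpha l).-1 v -> sphere_coord l (sphere_covector v) = v.
Proof.
move=> /Lambda_pP[Ll LI C0] [_ v0]; apply/rowP => i.
have [j jL <-] := L_rank_surj Ll i.
rewrite sphere_coord_rank// normv2_sphere_covector// mulrAC divff ?gt_eqF//
  mul1r sqrtr_sqr.
by rewrite ger0_norm.
Qed.

Lemma iso_equiv_sphere_covector u l : Gamma_inf A alpha p (u, l) ->
  iso_equiv A (sphere_covector (sphere_coord l u), l) (u, l).
Proof.
move=> Gu; have /Gamma_infP[Lp _ _] := Gu; have /Lambda_pP[Ll LI C0] := Lp.
apply/iso_equivP => //; first exact/sphere_covector_Gamma_inf/sphere_coord_ge0.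
split=> // j jL; rewrite normv2_sphere_covector// sphere_coord_rank// sqr_sqrtr.
  by rewrite mulrC divfK// gt_eqF.
by rewrite divr_ge0 ?normv2_ge0// ltW.
Qed.

(** * The homeomorphism *)

Lemma Lambda_discrete (l : R) : \forall y \near l, Lambda alpha y -> y = l.
Proof.
have h : \forall y \near l, forall j, Lambda_j alpha j y -> y = l.
  apply: (@filter_forall _ _ _ (nbhs l)) => j.
  have c0 : 0 < 2 * pi / alpha j by rewrite divr_gt0 ?mulr_gt0 ?pi_gt0
    ?alpha_gt0.
  have := lattice_isolated l c0; apply: filterS => y yl [m [ym _]].
  by apply: yl; exists m.
by apply: filterS h => y yl [j _]; exact: yl.
Qed.

Lemma continuous_normv2_proj j : continuous (fun u : rV => normv2 u.{j}).
Proof.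
have cj i : continuous (fun u : rV => u.{j} 0 i).
  rewrite /sv_proj; under eq_fun do rewrite mxE.
  apply: continuous_bigsum => a _; apply: continuous_mul;
    last exact: continuous_fcst.
  exact: coord_continuous.
by apply: continuous_bigsum => i _; apply: continuous_mul; exact: cj.
Qed.

Lemma continuous_sphere_coord l : continuous (sphere_coord l).
Proof.
apply: continuous_rV => i; under eq_fun do rewrite mxE.
apply: continuous_bigsum => j _ u.
apply: (@continuous_comp _ _ _ (fun u : rV =>
  normv2 u.{j} / radius2 l) Num.sqrt).
  apply: continuous_mul; last exact: continuous_fcst.
  exact: continuous_normv2_proj.
exact: sqrt_continuous.
Qed.

Lemma continuous_sphere_covector l : continuous
  (fun v : 'rV[R]_(ell alpha l).-1.+1 => (sphere_covector v, l) : G).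
Proof.
have c1 : continuous (fun v : 'rV[R]_(ell alpha l).-1.+1 =>
    \sum_(j in L alpha l) (Num.sqrt (radius2 l) * v 0 (L_rank l j)) *: unitv j).
  apply: continuous_bigsum => j _; apply: continuous_scal;
    apply: continuous_mul.
    exact: continuous_fcst.
  exact: coord_continuous.
have c2 : continuous (fun v : 'rV[R]_(ell alpha l).-1.+1 => sphere_covector v).
  by move=> v; exact: cvgD (cvg_cst _) (c1 v).
by move=> v; exact: cvg_pair (c2 v) (cvg_cst _).
Qed.

Local Notation Gi := (Gamma_inf A alpha p).
Local Notation Qt := (classes
  (fun eta1 eta2 : Gi => iso_equiv A (val eta1) (val eta2))).

Lemma Gi_mem (e : Gi) : Gi ((val e).1, (val e).2).
Proof. by rewrite -surjective_pairing; exact: set_valP. Qed.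

Lemma Gi_Lambda (e : Gi) : Lambda_p A alpha p (val e).2.
Proof. by have /Gamma_infP[] := Gi_mem e. Qed.

Definition to_sphere (e : Gi) : sphere_union A alpha p :=
  existT _ (exist _ (val e).2 (mem_set (Gi_Lambda e)) : Lambda_p A alpha p)
    (exist _ (sphere_coord (val e).2 (val e).1) (mem_set (sphere_coord_ge0
      (Gi_mem e)))).

(** The type of the sphere depends on [l], so the equality of the base points is substituted before
    the vectors are compared; membership proofs are boolean and hence unique. *)
Lemma to_sphereE (e : Gi) (l : Lambda_p A alpha p)
    (w : sphere_ge0 R (ell alpha (val l)).-1) :
  (val e).2 = val l -> sphere_coord (val l) (val e).1 = val w ->
  to_sphere e = existT _ l w.
Proof.
case: l w => l ml; case=> w mw /= el ew.
rewrite /to_sphere; move: (Gi_Lambda e) (sphere_coord_ge0 (Gi_mem e)).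
rewrite el => h1 h2.
have -> : mem_set h1 = ml by exact: bool_irrelevance.
by congr existT; exact: val_inj.
Qed.

(** Lambda is discrete, so covectors of [Gamma_inf] near [e] have the same [l] and stay in one
    summand, where [sphere_coord] is continuous. *)
Lemma to_sphere_continuous : continuous to_sphere.
Proof.
move=> e U [/= _ [[W oW <-] /= We WU]].
have : \forall y \near val e, W (sphere_coord (val e).2 y.1) /\
    (Lambda alpha y.2 -> y.2 = (val e).2).
  apply: filterI.
    apply: (@continuous_comp _ _ _ (fun y : G => y.1) (sphere_coord (val e).2)).
    - exact: cvg_fst.
    - exact: continuous_sphere_coord.
    - exact: open_nbhs_nbhs.
  have := Lambda_discrete (val e).2.
  exact: (@cvg_snd _ _ (nbhs (val e).1) (nbhs (val e).2)).
move=> /(@initial_continuous _ _ (set_val : Gi -> G) e) ne.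
apply: (@filterS _ (nbhs e) (nbhs_filter e) _ _ _ ne) => e' /= [We' le'].
have Lp' := Gi_Lambda e'; have /Lambda_pP[Ll' _ _] := Lp'.
have el := le' Ll'.
have h2 : sphere_ge0 R (ell alpha (val e).2).-1 (sphere_coord (val e).2 (val
  e').1).
  by rewrite -el; exact/sphere_coord_ge0/Gi_mem.
rewrite (@to_sphereE e' (exist _ (val e).2 (mem_set (Gi_Lambda e)))
  (exist _ (sphere_coord (val e).2 (val e').1) (mem_set h2)))//.
exact: WU.
Qed.

Definition of_sphere (l : Lambda_p A alpha p)
    (w : sphere_ge0 R (ell alpha (val l)).-1) : Gi :=
  exist _ (sphere_covector (val w), val l)
    (mem_set (sphere_covector_Gamma_inf (set_valP l) (set_valP w))).

Lemma of_sphere_continuous l : continuous (@of_sphere l).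
Proof.
apply: (@continuous_comp_initial _ _ _ (set_val : Gi -> G)).
move=> w; apply: (@continuous_comp _ _ _ set_val
  (fun v : 'rV[R]_(ell alpha (val l)).-1.+1 => (sphere_covector v, val l) : G)).
  exact: initial_continuous.
exact: continuous_sphere_covector.
Qed.

Lemma to_of_sphere l w : to_sphere (@of_sphere l w) = existT _ l w.
Proof. by apply: to_sphereE => //=; rewrite sphere_coordK//;
  exact: set_valP. Qed.

Lemma to_sphere_iso (e1 e2 : Gi) :
  iso_equiv A (val e1) (val e2) -> to_sphere e1 = to_sphere e2.
Proof.
move=> /(iso_equivP (set_valP e1) (set_valP e2)) [le ue].
apply: to_sphereE => //=.
by apply/rowP => i; rewrite !mxE; apply: eq_bigr => j /andP[jL _];
  rewrite ue// le.
Qed.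

(** Equality of classes means equivalence once the relation is known to be reflexive and transitive
    in the form [tr]; both are read off from the invariants in [iso_equivP]. *)
Lemma pi_isoP (e1 e2 : Gi) :
  \pi_(quotient_topology Qt)%qT e1 = \pi_(quotient_topology Qt)%qT e2 <->
  iso_equiv A (val e1) (val e2).
Proof.
have refl (e : Gi) : iso_equiv A (val e) (val e).
  by apply/(iso_equivP (set_valP e) (set_valP e)).
have tr (a b c : Gi) : iso_equiv A (val a) (val b) ->
    iso_equiv A (val a) (val c) -> iso_equiv A (val b) (val c).
  move=> /(iso_equivP (set_valP a) (set_valP b)) [ab uab].
  move=> /(iso_equivP (set_valP a) (set_valP c)) [ac uac].
  apply/(iso_equivP (set_valP b) (set_valP c)); rewrite -ab; split => // j jL.
  by rewrite -uab// uac.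
have piE (e : Gi) : \pi_(quotient_topology Qt)%qT e = classes_pi _ e.
  by rewrite unlock.
rewrite !piE; split=> [/(congr1 (@proj1_sig _ _))/= h|h].
  have : eclass (fun e e' : Gi => iso_equiv A (val e) (val e')) e2 e2 := refl
    e2.
  by rewrite -h.
apply: eq_exist => /=; rewrite eqEsubset; split=> c /= hc; first exact: tr h hc.
exact: tr (tr _ _ _ h (refl e1)) hc.
Qed.

(** [to_sphere] is constant on classes and so descends to the quotient; its inverse is the section
    [of_sphere] followed by the projection, whose continuity is checked on each summand. *)
Lemma Gamma_inf_bar_homeomorphic :
  homeomorphic (Gamma_inf_bar A alpha p) (sphere_union A alpha p).
Proof.
pose Q := quotient_topology Qt.
exists (to_sphere \o (repr : Q -> Gi)).
exists (fun s : sphere_union A alpha p =>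
  \pi_Q%qT (of_sphere (projT2 s))).
split.
- apply: repr_comp_continuous; first exact: to_sphere_continuous.
  by move=> a b /eqP /pi_isoP/to_sphere_iso ->.
- apply: (@sigT_continuous _ _ _ (fun l w => \pi_Q%qT (@of_sphere l w))) => l w.
  apply: (@continuous_comp _ _ _ (@of_sphere l) \pi_Q%qT).
    exact: of_sphere_continuous.
  exact: pi_continuous.
- move=> c /=; rewrite -[RHS]reprK; apply/pi_isoP => /=.
  move: (repr c) => e; case: e => -[u l] /= m.
  exact/iso_equiv_sphere_covector/set_mem.
- case=> l w /=; rewrite -[RHS]to_of_sphere; apply: to_sphere_iso.
  by apply/pi_isoP; rewrite reprK.
Qed.

End FixedEndpoint.

End ContactGroup.

Theorem theorem6 (R : realType) (n : nat) (A : 'M[R]_(2 * n)) (k : nat)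
    (alpha : 'I_k -> R) (p : carnot R n)
    (n_gt0 : (0 < n)%N)
    (A_contact : contact_matrix A)
    (alpha_sv : distinct_singular_values A alpha)
    (p_neq0 : p <> p0 R n) :
  homeomorphic (Gamma_inf_bar A alpha p) (sphere_union A alpha p).
Proof. exact: Gamma_inf_bar_homeomorphic. Qed.
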